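(* Let $M$ be a complete connected non-compact Riemannian manifold, $\alpha\in(0,1)$, $q>1$, and $\sigma$ a Radon measure on $M$. Assume that the fractional Laplacian $(-\Delta)^\alpha$ is transient, and suppose that its Green kernel $G^{(\alpha)}$ is quasi-metric. Fix $o\in M$ and $a>0$ and set $m(x)=G^{(\alpha)}(x,o)\wedge a^{-1}$ for $x\in M$. Then there exists a positive solution $u$ to the integral inequality $$u(x)\ge\int_M G^{(\alpha)}(x,y)\,u^q(y)\,d\sigma(y)$$ if and only if the following two conditions hold: $$\int_M m^q(x)\,d\sigma(x)<\infty,$$ and there is a constant $C>0$ such that, for all $r>a$, $$\sup_{x\in M}\int_{\{y\in M:\,G^{(\alpha)}(o,y)>r^{-1}\}}G^{(\alpha)}(x,y)\,d\sigma(y)\le C\,r^{q-1}.$$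
   Context: $\mu$ is the Riemannian measure; $\Delta$ is the Laplace–Beltrami operator (the unique self-adjoint extension on $L^2(M,\mu)$ of $\Delta|_{C_c^\infty(M)}$), and $p_t(x,y)$, $t>0$, is the heat kernel, i.e. the smooth positive integral kernel (with respect to $\mu$) of $e^{t\Delta}$. The Green kernel of the fractional Laplacian $(-\Delta)^\alpha$ is $$G^{(\alpha)}(x,y)=\frac1{\Gamma(\alpha)}\int_0^\infty s^{\alpha-1}p_s(x,y)\,ds\in(0,+\infty],\qquad x,y\in M.$$ $(-\Delta)^\alpha$ is transient if there is a non-negative measurable function $f$ on $M$ with $\mu(\{f>0\})>0$ and $\int_M G^{(\alpha)}(x,y)f(y)\,d\mu(y)<+\infty$ for $\mu$-a.e. $x\in M$. $G^{(\alpha)}$ is quasi-metric if there is a constant $\kappa\ge1$ such that $G^{(\alpha)}(x,y)\wedge G^{(\alpha)}(y,z)\le\kappa G^{(\alpha)}(x,z)$ for all $x,y,z\in M$. A Radon measure is a locally finite Borel measure. Positive solution: let $u$ be a $\sigma$-a.e. defined function that admits a lower semi-continuous $\sigma$-version (an everywhere defined lower semi-continuous function equal to $u$ $\sigma$-a.e.); $u$ is called a positive solution to the integral inequality if for $\sigma$-a.e. $x\in M$ one has $u(x)\in(0,+\infty)$ and the integral inequality holds at $x$. $\wedge$ denotes minimum. *)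

(* Defs.v *)
From HB Require Import structures.
From mathcomp Require Import all_boot all_order all_algebra.
From mathcomp Require Import all_classical all_reals all_analysis.

Set Implicit Arguments.
Unset Strict Implicit.
Unset Printing Implicit Defensive.

Import Order.TTheory GRing.Theory Num.Theory.
Import numFieldNormedType.Exports.

Local Open Scope classical_set_scope.
Local Open Scope ring_scope.

Notation borel M := (g_sigma_algebraType (@open M)).

Section smooth_functions.
Context {R : realType} {V W : normedModType R}.

(* [U] is meant to be open and [V] finite-dimensional: then [f] is of class C^k
   on [U] iff all its iterated directional derivatives of order at most [k]
   exist and are continuous on [U]. *)
Fixpoint Ck_on (k : nat) (U : set V) (f : V -> W) : Prop :=
  (forall x, U x -> {for x, continuous f}) /\
  (if k is k'.+1 then
     forall v, (forall x, U x -> derivable f x v) /\ Ck_on k' U ('D_v f)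
   else True).

Definition smooth_on (U : set V) (f : V -> W) : Prop := forall k, Ck_on k U f.

End smooth_functions.

(* Only the values of [cmap] on [cdom] and of [cinv] on the image of [cdom] are
   meaningful. *)
Record chart (R : realType) (n : nat) (M : Type) := Chart {
  cdom : set M ;
  cmap : M -> 'rV[R]_n ;
  cinv : 'rV[R]_n -> M }.

Definition cimg (R : realType) n M (c : chart R n M) : set 'rV[R]_n :=
  cmap c @` cdom c.

Definition is_chart (R : realType) n (M : topologicalType) (c : chart R n M) :=
  [/\ open (cdom c), open (cimg c),
      (forall x, cdom c x -> cinv c (cmap c x) = x),
      (forall x, cdom c x -> {for x, continuous (cmap c)}) &
      (forall v, cimg c v -> {for v, continuous (cinv c)})].

(* A C^oo atlas on M together with a Riemannian metric; [gram c v] is the matrix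
   (g_ij) of the metric in the chart [c] at the point of coordinates [v].
   Tangent vectors are written as row vectors. *)
Record riemannian_manifold (R : realType) (n : nat) (M : topologicalType) :=
  RiemannianManifold {
  mfd_hausdorff : hausdorff_space M ;
  mfd_second_countable : @second_countable M ;
  atlas : set (chart R n M) ;
  chart_at : M -> chart R n M ;
  atlas_chart : forall c, atlas c -> is_chart c ;
  chart_at_atlas : forall x, atlas (chart_at x) ;
  chart_at_dom : forall x, cdom (chart_at x) x ;
  atlas_compat : forall c d, atlas c -> atlas d ->
    smooth_on (cmap c @` (cdom c `&` cdom d)) (cmap d \o cinv c) ;
  gram : chart R n M -> 'rV[R]_n -> 'M[R]_n ;
  gram_smooth : forall c, atlas c -> smooth_on (cimg c) (gram c) ;
  gram_sym : forall c v, atlas c -> cimg c v -> (gram c v)^T = gram c v ;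
  gram_pos : forall c v (w : 'rV[R]_n), atlas c -> cimg c v -> w != 0 ->
    0 < (w *m gram c v *m w^T) 0 0 ;
  gram_compat : forall c d x (w w' : 'rV[R]_n), atlas c -> atlas d ->
    cdom c x -> cdom d x ->
    let phi := cmap d \o cinv c in
    w *m gram c (cmap c x) *m w'^T =
    'D_w phi (cmap c x) *m gram d (cmap d x) *m ('D_w' phi (cmap c x))^T }.

Section riemannian_geometry.
Context {R : realType} {n : nat} {M : ptopologicalType}.
Variable g : riemannian_manifold R n M.
Implicit Types (c d : chart R n M) (f : M -> R) (x y : M).

Definition volume_density c (v : 'rV[R]_n) : R := Num.sqrt (\det (gram g c v)).

Definition is_lebesgue (lam : {measure set (borel 'rV[R]_n) -> \bar R}) :=
  forall a b : 'rV[R]_n, (forall i, a 0 i <= b 0 i) ->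
    lam [set v : 'rV[R]_n | forall i, a 0 i < v 0 i <= b 0 i] =
    (\prod_i (b 0 i - a 0 i))%:E.

Definition is_riemannian_measure (mu : {measure set (borel M) -> \bar R}) :=
  exists2 lam, is_lebesgue lam &
    forall c, atlas g c -> forall A : set (borel M), measurable A ->
      A `<=` cdom c ->
      mu A = (\int[lam]_(v in cmap c @` A) (volume_density c v)%:E)%E.

Definition curve_length c (gam : R^o -> 'rV[R]_n) : R :=
  \int[lebesgue_measure]_(t in `[0, 1])
    Num.sqrt (('D_1 gam t *m gram g c (gam t) *m ('D_1 gam t)^T) 0 0).

(* [path_length x y L]: some piecewise C^1 curve from [x] to [y] has length [L].
   The curve is cut into finitely many C^1 arcs each lying in a single chart. *)
Inductive path_length : M -> M -> R -> Prop :=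
| path_nil x : path_length x x 0
| path_arc x c (gam : R^o -> 'rV[R]_n) L :
    atlas g c -> Ck_on 1 [set: R^o] gam ->
    (forall t : R, 0 <= t <= 1 -> cimg c (gam t)) ->
    path_length x (cinv c (gam 0)) L ->
    path_length x (cinv c (gam 1)) (L + curve_length c gam).

Definition riemannian_dist x y : \bar R :=
  ereal_inf [set L%:E | L in path_length x y].

Definition complete_manifold :=
  forall z : nat -> M,
    (forall e : R, 0 < e -> exists N, forall i j, (N <= i)%N -> (N <= j)%N ->
       (riemannian_dist (z i) (z j) < e%:E)%E) ->
    exists l : M, z @ \oo --> l.

Definition smooth_function f := forall c, atlas g c ->
  smooth_on (cimg c) (f \o cinv c : 'rV[R]_n -> R^o).

Definition test_function f :=
  smooth_function f /\ compact (closure [set x | f x != 0]).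

(* (det g)^(-1/2) sum_ij d_i ((det g)^(1/2) g^ij d_j f) in local coordinates;
   the value does not depend on the chart. *)
Definition laplace_beltrami f x : R :=
  let c := chart_at g x in
  let flux i (v : 'rV[R]_n) : R^o :=
    volume_density c v *
    \sum_j invmx (gram g c v) i j *
      'D_(delta_mx 0 j) (f \o cinv c : 'rV[R]_n -> R^o) v in
  (volume_density c (cmap c x))^-1 *
  \sum_i 'D_(delta_mx 0 i) (flux i) (cmap c x).

End riemannian_geometry.

Section heat_kernel.
Context {R : realType} {n : nat} {M : ptopologicalType}.
Variables (g : riemannian_manifold R n M).
Variable mu : {measure set (borel M) -> \bar R}.
Implicit Types (f h phi psi : M -> R) (A : (M -> R) -> (M -> R) -> Prop).

Definition L2 f : Prop := (f : borel M -> R) \in Lfun mu 2%:E.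

Definition L2norm f : \bar R := 'N[mu]_2%:E [EFin \o (f : borel M -> R)].

Definition L2inner f h : R := \int[mu]_(x in [set: borel M]) (f x * h x).

(* Operators on L^2(M, mu) are given by their graph: [A f h] means that (the
   class of) [f] is in the domain and is sent to (the class of) [h]. The third
   clause is A = A^*; the second one makes the domain dense. *)
Definition is_laplacian A :=
  [/\ forall f h, A f h -> L2 f /\ L2 h,
      forall f, test_function g f -> A f (laplace_beltrami g f) &
      forall f h, L2 f -> L2 h ->
        (A f h <-> forall phi psi, A phi psi -> L2inner h phi = L2inner f psi)].

(* [P t] is e^(tA): the strongly continuous symmetric contraction semigroup on
   L^2(M, mu) with infinitesimal generator [A]. *)
Record is_exp_semigroup A (P : R -> (M -> R) -> (M -> R)) : Prop := {
  sg_L2 : forall t f, 0 <= t -> L2 f -> L2 (P t f) ;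
  sg_linear : forall t (a : R) f h, 0 <= t -> L2 f -> L2 h ->
    {ae mu, forall x, P t (a \*o f \+ h) x = a * P t f x + P t h x} ;
  sg_contraction : forall t f, 0 <= t -> L2 f -> (L2norm (P t f) <= L2norm f)%E ;
  sg_symmetric : forall t f h, 0 <= t -> L2 f -> L2 h ->
    L2inner (P t f) h = L2inner f (P t h) ;
  sg_0 : forall f, L2 f -> {ae mu, forall x, P 0 f x = f x} ;
  sg_add : forall s t f, 0 <= s -> 0 <= t -> L2 f ->
    {ae mu, forall x, P (s + t) f x = P s (P t f) x} ;
  sg_continuous : forall f, L2 f ->
    L2norm (P t f \- f) @[t --> 0^'+] --> 0%E ;
  sg_generator : forall f h, L2 f -> L2 h ->
    (A f h <->
     L2norm (fun x => t^-1 * (P t f x - f x) - h x) @[t --> 0^'+] --> 0%E) }.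

Definition smooth_kernel (p : R -> M -> M -> R) :=
  forall c d, atlas g c -> atlas g d ->
    smooth_on [set z : R^o * ('rV[R]_n * 'rV[R]_n) |
                 [/\ 0 < z.1, cimg c z.2.1 & cimg d z.2.2]]
      ((fun z => p z.1 (cinv c z.2.1) (cinv d z.2.2))
         : R^o * ('rV[R]_n * 'rV[R]_n) -> R^o).

Definition is_heat_kernel (p : R -> M -> M -> R) :=
  exists A P,
  [/\ is_laplacian A, is_exp_semigroup A P, smooth_kernel p,
      forall t x y, 0 < t -> 0 < p t x y &
      forall t f, 0 < t -> L2 f ->
        {ae mu, forall x,
           mu.-integrable [set: borel M] (fun y => (p t x y * f y)%:E) /\
           P t f x = \int[mu]_(y in [set: borel M]) (p t x y * f y)}].

End heat_kernel.

Section green_kernel.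
Context {R : realType} {M : ptopologicalType}.
Local Open Scope ereal_scope.

Definition Gamma (a : R) : R :=
  \int[lebesgue_measure]_(s in `]0%R, +oo[) (s `^ (a - 1) * expR (- s))%R.

Definition green (p : R -> M -> M -> R) (alpha : R) (x y : M) : \bar R :=
  ((Gamma alpha)^-1)%:E *
  \int[lebesgue_measure]_(s in `]0%R, +oo[) (s `^ (alpha - 1) * p s x y)%:E.

Definition transient (mu : {measure set (borel M) -> \bar R})
    (G : M -> M -> \bar R) :=
  exists f : borel M -> R,
    [/\ measurable_fun setT f, forall x, (0 <= f x)%R,
        0 < mu [set x | (0 < f x)%R] &
        {ae mu, forall x, \int[mu]_y (G x y * (f y)%:E) < +oo}].

Definition quasi_metric (G : M -> M -> \bar R) :=
  exists2 kappa : R, (1 <= kappa)%R &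
    forall x y z, Order.min (G x y) (G y z) <= kappa%:E * G x z.

Definition locally_finite (sigma : {measure set (borel M) -> \bar R}) :=
  forall x : M, exists U : set M, [/\ open U, U x & sigma U < +oo].

Definition positive_solution (G : M -> M -> \bar R) (q : R)
    (sigma : {measure set (borel M) -> \bar R}) (u : M -> \bar R) :=
  (exists2 v : M -> \bar R, lower_semicontinuous v &
     {ae sigma, forall x, u x = v x}) /\
  {ae sigma, forall x,
     0 < u x < +oo /\ \int[sigma]_y (G x y * u y `^ q) <= u x}.

End green_kernel.

(* Main.v *)
Require Import Defs.
From HB Require Import structures.
From mathcomp Require Import all_boot all_order all_algebra.
From mathcomp Require Import perm ring lra.
From mathcomp Require Import all_classical all_reals all_analysis.
From mathcomp Require Import measurable_realfun.

Set Implicit Arguments.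
Unset Strict Implicit.
Unset Printing Implicit Defensive.

Import Order.TTheory GRing.Theory Num.Theory.
Import numFieldNormedType.Exports.

Local Open Scope classical_set_scope.
Local Open Scope ring_scope.

(** Write G for the Green kernel and think of d = 1 / G as a quasi-distance:
    quasi-metricity is the ultrametric-type inequality
    d(x, z) <= kappa max(d(x, y), d(y, z)). The sets {G(o, .) > 1 / r} are the
    balls B(o, r) of d, and m(x) = 1 / max(d(x, o), a). All that the geometry
    has to provide is that G is positive, symmetric and lower semicontinuous;
    the rest is an argument about such a kernel on a measurable space.

    Sufficiency. A small multiple of m is a solution once G(m^q sigma) <= C m
    (exists_scaled_supersolution). To bound the integral of G(x, y) m(y)^q,
    note that either G(x, y) <= kappa m(x), and such y contribute at most
    kappa m(x) times the integral of m^q, or y lies in a ball B(o, r) with r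
    comparable to 1 / m(x) and m(y) <= kappa m(x), and then the ball condition
    gives a contribution of order m(x)^q r^(q - 1), that is m(x)
    (kernel_le_or_mem_shell, potential_truncation_le).

    Necessity. Let v be a solution. Restricting the integral to a ball, where
    G(x, y) is at least a constant times m(x), gives v >= c m
    (exists_truncation_minorant). Both conditions then come from one
    elementary fact (integral_le_of_superlinear_growth): if
    Phi(y) = delta + (integral of f over the part of D on which psi <= psi(y))
    and g Phi^q <= K f, then the integral of g is at most a constant times
    K delta^(1 - q), as in the comparison of a superlinear differential
    inequality with its blow-up. For the ball condition take D = B(o, r), a
    point x, psi = g = G(x, .) and f = G(x, .) v^q: quasi-metricity gives
    G(x, z) <= kappa G(y, z) as soon as G(x, z) <= G(x, y), so the inequality
    for v at y, together with v >= c / r on the ball, reads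
    v(y) >= Phi(y) / (2 kappa) with delta = kappa c / r
    (potential_ball_le). For the integral of m^q take D outside of a ball,
    psi = - G(o, .), f = v^q and g = G(o, .)^q: here G(y, z) is at least
    G(o, y) / kappa for every z nearer to o than y
    (integral_truncation_lty).

    Geometry. The heat kernel is continuous because it is smooth in charts.
    Its symmetry follows from the self-adjointness of the semigroup tested on
    indicators of small sets, since every neighbourhood contains a set of
    positive finite Riemannian measure (exists_small_measurable_nbhd,
    heat_kernel_sym). Symmetry passes to G, and Fatou's lemma along sequences
    gives the lower semicontinuity (green_lower_semicontinuous). *)

(** * Integrals and null sets *)

Section integrals.
Local Open Scope ereal_scope.

(** Here the carrier is read off [mu]: M and [borel M] are convertible, and the
    filter structure of the null sets is attached to the latter only. *)
Lemma ae_imply d (T : measurableType d) (R : realType)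
    (mu : {measure set T -> \bar R}) (P Q : T -> Prop) :
  {ae mu, forall x, P x} -> (forall x, P x -> Q x) -> {ae mu, forall x, Q x}.
Proof. by move=> aeP PQ; apply: filterS aeP. Qed.

Lemma ae_imply2 d (T : measurableType d) (R : realType)
    (mu : {measure set T -> \bar R}) (P Q S : T -> Prop) :
  {ae mu, forall x, P x} -> {ae mu, forall x, Q x} ->
  (forall x, P x -> Q x -> S x) -> {ae mu, forall x, S x}.
Proof. by move=> aeP aeQ PQS; apply: filterS2 aeP aeQ. Qed.

Lemma ae_exists d (T : measurableType d) (R : realType)
    (mu : {measure set T -> \bar R}) (P : T -> Prop) :
  0 < mu [set: T] -> {ae mu, forall x, P x} -> exists x, P x.
Proof.
move=> mu0 [N [mN N0 PN]]; apply: contrapT => /forallNP nP.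
have : mu [set: T] <= mu N.
  by apply: le_measure; rewrite ?inE// => x _; apply: PN => /=; exact: nP.
by rewrite N0 leNgt mu0.
Qed.

Lemma ge0_integral_gt0 d (T : measurableType d) (R : realType)
    (mu : {measure set T -> \bar R}) (D : set T) (f : T -> \bar R) :
  measurable D -> measurable_fun D f -> (forall x, D x -> 0 <= f x) ->
  {ae mu, forall x, D x -> 0 < f x} -> 0 < mu D ->
  0 < \int[mu]_(x in D) f x.
Proof.
move=> mD mf f0 fpos muD; rewrite lt_neqAle integral_ge0// andbT.
apply/eqP => int0.
have /(ae_eq_integral_abs mu mD mf) f_eq0 : \int[mu]_(x in D) `|f x| = 0.
  rewrite [RHS]int0; apply: eq_integral => x /set_mem Dx.
  by rewrite gee0_abs// f0.
have [N [mN N0 DN]] : {ae mu, forall x, ~ D x}.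
  apply: filterS2 fpos f_eq0 => x fx fx0 Dx.
  by have := fx Dx; rewrite (fx0 Dx) ltxx.
have : mu D <= mu N.
  by apply: le_measure; rewrite ?inE// => x Dx; apply: DN => /=; exact.
by rewrite N0 leNgt muD.
Qed.

Lemma ge0_integral_null d (T : measurableType d) (R : realType)
    (mu : {measure set T -> \bar R}) (D : set T) (f : T -> \bar R) :
  measurable D -> measurable_fun [set: T] f -> mu [set: T] = 0 ->
  \int[mu]_(x in D) f x = 0.
Proof.
move=> mD mf muT; apply: null_set_integral => //; first exact: measurable_funTS.
by apply/eqP; rewrite -measure_le0 -muT le_measure// inE.
Qed.

(** The integral of a nonnegative function is a supremum over the simple functions
    below it, so cutting [f] off on a null set makes the comparison pointwise.
    This is how an inequality for a function known only up to a null set passes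
    to its semicontinuous version. *)
Lemma le_integral_of_ae_eq d (T : measurableType d) (R : realType)
    (mu : {measure set T -> \bar R}) (f h : T -> \bar R) :
  measurable_fun [set: T] f -> (forall x, 0 <= f x) -> (forall x, 0 <= h x) ->
  {ae mu, forall x, f x = h x} -> \int[mu]_x f x <= \int[mu]_x h x.
Proof.
move=> mf f0 h0 [N [mN N0 fh]].
rewrite (ge0_negligible_integral mN)// setTD integral_mkcond.
rewrite !ge0_integralTE//; last by apply: erestrict_ge0.
apply: ereal_sup_le => _ [k kf <-]; exists k => // x.
apply: le_trans (kf x) _; rewrite /patch; case: ifPn => // /set_mem Nx.
by rewrite (_ : f x = h x)//; apply: contrapT => fhx; apply: Nx; exact: fh.
Qed.

End integrals.

Lemma ae_le_Rintegral d (T : measurableType d) (R : realType)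
    (mu : {measure set T -> \bar R}) (f1 f2 : T -> R) :
  mu.-integrable [set: T] (EFin \o f1) -> mu.-integrable [set: T] (EFin \o f2) ->
  {ae mu, forall x, f1 x <= f2 x} ->
  \int[mu]_x f1 x <= \int[mu]_x f2 x.
Proof.
move=> if1 if2 [N [mN N0 f12]].
have RintE f : mu.-integrable [set: T] (EFin \o f) ->
    \int[mu]_x f x = \int[mu]_(x in ~` N) f x.
  by move=> fi; congr fine; rewrite (negligible_integral mN)// setTD.
have mCN : measurable (~` N) by exact: measurableC.
rewrite !RintE//; apply: le_Rintegral => //.
- exact: integrableS if1.
- exact: integrableS if2.
- by move=> x Nx; apply: contrapT => f12x; apply: Nx; exact: f12.
Qed.

Lemma limn_einf_le (R : realType) (u : (\bar R)^nat) (c : \bar R) :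
  (forall k, u k <= c)%E -> (limn_einf u <= c)%E.
Proof.
move=> uc; rewrite limn_einf_lim; apply: lime_le; first exact: is_cvg_einfs.
apply: nearW => k; apply: le_trans (uc k).
by apply: ereal_inf_lbound; exists k => /=.
Qed.

(** * Integrals over the level sets of a function *)

Section powers.
Local Open Scope ereal_scope.

Lemma poweR_le (R : realType) (x y : \bar R) (r : R) :
  (0 <= r)%R -> 0 <= x -> x <= y -> x `^ r <= y `^ r.
Proof.
move=> r0 x0 xy; apply: gt0_ler_poweR => //; rewrite in_itv/= leey andbT//.
exact: le_trans xy.
Qed.

Lemma powR2_onem_lt1 (R : realType) (q : R) : (1 < q -> 2 `^ (1 - q) < 1)%R.
Proof.
move=> q1; rewrite -opprB powRN invf_lt1 ?powR_gt0//.
have {1}<- : (1 `^ (q - 1) = 1 :> R)%R by rewrite powR1.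
by rewrite gt0_ltr_powR ?nnegrE ?subr_gt0 ?ltr1n.
Qed.

End powers.

Section level_sets.
Local Open Scope ereal_scope.
Context d (T : measurableType d) (R : realType).
Variables (sigma : {measure set T -> \bar R}) (psi : T -> \bar R).
Hypothesis mpsi : measurable_fun [set: T] psi.

(** Along a sequence of points of [A] the function [psi] tends to its supremum
    over [A], and when the supremum is attained a constant sequence does. Hence a
    down-closed set, however it was defined, is a countable increasing union of
    sublevel sets, which makes it measurable and reduces integrals over it to
    integrals over sublevel sets. *)
Lemma down_closed_exhaustion (A : set T) : A !=set0 ->
  (forall y z, A y -> psi z <= psi y -> A z) ->
  exists y : nat -> T,
    [/\ forall n, A (y n), forall n, psi (y n) <= psi (y n.+1) &
        A = \bigcup_n [set z | psi z <= psi (y n)]].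
Proof.
move=> [a Aa] Adown.
have [y [Ay yA]] : exists y : nat -> T,
    (forall n, A (y n)) /\ forall z, A z -> exists n, psi z <= psi (y n).
  have [[y Ay yE]|supA] := pselect ((psi @` A) (ereal_sup (psi @` A))).
    exists (fun=> y); split=> // z Az; exists 0%N.
    by rewrite yE; apply: ereal_sup_ubound; exists z.
  have [|u uA ucvg] := @ereal_sup_seq R (psi @` A).
    by apply/set0P; exists (psi a), a.
  have /choice[y yP] : forall n, exists y, A y /\ psi y = u n.
    by move=> n; have [y Ay yE] := uA n; exists y.
  exists y; split=> [n|z Az]; first by case: (yP n).
  have zlt : psi z < ereal_sup (psi @` A).
    rewrite lt_neqAle ereal_sup_ubound; last by exists z.
    by rewrite andbT; apply/eqP => zE; apply: supA; rewrite -zE; exists z.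
  apply: contrapT => /forallNP zgt; move: zlt; rewrite ltNge => /negP; apply.
  apply: cvge_le ucvg; apply: nearW => n.
  by rewrite -(yP n).2 ltW// ltNge; apply/negP.
(* running maximum of the sequence, for psi *)
pose y' := fix y' n := if n is m.+1 then
  (if psi (y' m) <= psi (y m.+1) then y m.+1 else y' m) else y 0%N.
have Ay' n : A (y' n) by elim: n => [|n IH] /=; [exact: Ay|case: ifP].
have yy' n : psi (y n) <= psi (y' n).
  case: n => [|n] /=; first exact: lexx.
  by case: ifP => [_|/negbT]; [exact: lexx|rewrite -ltNge => /ltW].
exists y'; split => //.
  by move=> n /=; case: ifP.
apply/seteqP; split=> [z Az|z [n _ /=]]; last exact: Adown.
have [n zn] := yA _ Az; exists n => //=.
exact: le_trans zn (yy' n).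
Qed.

Lemma measurable_sublevel y : measurable [set z | psi z <= psi y].
Proof. by rewrite -[X in measurable X]setTI; exact: emeasurable_fun_infty_c. Qed.

Lemma measurable_down_closed (A : set T) :
  (forall y z, A y -> psi z <= psi y -> A z) -> measurable A.
Proof.
move=> Adown; have [->//|/set0P A0] := eqVneq A set0.
have [y [_ _ ->]] := down_closed_exhaustion A0 Adown.
by apply: bigcupT_measurable => n; exact: measurable_sublevel.
Qed.

Variables (D : set T) (f : T -> \bar R).
Hypotheses (mD : measurable D) (mf : measurable_fun [set: T] f).
Hypothesis f0 : forall x, 0 <= f x.

Lemma integral_down_closed_le (A : set T) (c : \bar R) : 0 <= c ->
  (forall y z, A y -> psi z <= psi y -> A z) ->
  (forall y, A y -> \int[sigma]_(z in D `&` [set z | psi z <= psi y]) f z <= c) ->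
  \int[sigma]_(z in D `&` A) f z <= c.
Proof.
move=> c0 Adown Ac; have [->|/set0P A0] := eqVneq A set0.
  by rewrite setI0 integral_set0.
have [y [Ay yS AE]] := down_closed_exhaustion A0 Adown.
pose F n := D `&` [set z | psi z <= psi (y n)].
have -> : D `&` A = \bigcup_n F n by rewrite AE setI_bigcupr.
have mF n : measurable (F n) by apply: measurableI => //; exact: measurable_sublevel.
have ndF : nondecreasing_seq F.
  apply/nondecreasing_seqP => n; apply/subsetPset => z [Dz /= zn].
  by split=> //=; exact: le_trans zn (yS n).
have cvgF : \int[sigma]_(z in F n) f z @[n --> \oo] -->
            \int[sigma]_(z in \bigcup_n F n) f z.
  by apply: ge0_nondecreasing_set_cvg_integral => // n; exact: measurable_funTS.
rewrite -(cvg_lim _ cvgF)//; apply: lime_le; first by apply/cvg_ex; eexists; exact: cvgF.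
by apply: nearW => n; exact: Ac.
Qed.


Variables (g : T -> \bar R) (q delta K : R).
Hypotheses (mg : measurable_fun [set: T] g) (g0 : forall x, 0 <= g x).
Hypotheses (q1 : (1 < q)%R) (delta0 : (0 < delta)%R) (K0 : (0 <= K)%R).

(** Cut [D] into the strata where Phi lies in [2^k delta, 2^(k+1) delta[. On the
    k-th one g is at most K (2^k delta)^(-q) f, and the stratum is part of a
    down-closed set on which f has integral at most 2^(k+1) delta. The bounds form
    a geometric series of ratio 2^(1 - q), convergent because q > 1. It is a
    discrete version of the convergence at infinity of the integral of
    dPhi / Phi^q. *)
Lemma integral_le_of_superlinear_growth :
  let Phi y := delta%:E + \int[sigma]_(z in D `&` [set z | psi z <= psi y]) f z in
  {ae sigma, forall y, D y -> Phi y < +oo /\ g y * Phi y `^ q <= K%:E * f y} ->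
  \int[sigma]_(y in D) g y <=
    (2 * K * delta `^ (1 - q) / (1 - 2 `^ (1 - q)))%:E.
Proof.
move=> Phi PhiP.
have q0 : (0 <= q)%R by rewrite ltW// (lt_trans _ q1).
have Phi_ge y : delta%:E <= Phi y by rewrite leeDl// integral_ge0.
have Phi_mono y z : psi z <= psi y -> Phi z <= Phi y.
  move=> zy; rewrite leeD2l// ge0_subset_integral//.
  - by apply: measurableI => //; exact: measurable_sublevel.
  - by apply: measurableI => //; exact: measurable_sublevel.
  - exact: measurable_funTS.
  - by apply: setIS => x /= xz; exact: le_trans xz zy.
pose b k : R := (delta * 2 ^+ k)%R.
have b0 k : (0 < b k)%R by rewrite mulr_gt0// exprn_gt0.
pose S k := [set y | Phi y < (b k)%:E].
have Sdown k y z : S k y -> psi z <= psi y -> S k z.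
  by move=> Sy /Phi_mono zy; exact: le_lt_trans zy Sy.
have mS k : measurable (S k) by exact: measurable_down_closed (@Sdown k).
have S_mono k l : (k <= l)%N -> S k `<=` S l.
  move=> kl y Sy; apply: lt_le_trans Sy _.
  by rewrite lee_fin ler_pM2l// ler_weXn2l// ler1n.
pose E k := D `&` (S k.+1 `\` S k).
have mE k : measurable (E k) by apply: measurableI => //; exact: measurableD.
have tE : trivIset [set: nat] E.
  apply: ltn_trivIset => m k mk; apply/seteqP; split=> // y [[_ [S1 nS]] [_ [S2 nS']]].
  by apply: nS'; apply: S_mono S1.
(* the integral of f up to the level of y is below Phi y, hence below b k on S k *)
have intSf k : \int[sigma]_(y in D `&` S k) f y <= (b k)%:E.
  apply: integral_down_closed_le; [by rewrite lee_fin ltW|exact: Sdown|].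
  by move=> y Sy; apply: le_trans (ltW Sy); rewrite leeDr// lee_fin ltW.
have intEg k : \int[sigma]_(y in E k) g y <=
    ((2 * K * delta `^ (1 - q))%R * (2 `^ (1 - q)) ^+ k)%:E.
  pose c := (K * (b k) `^ (- q))%R.
  have c0 : (0 <= c)%R by rewrite mulr_ge0// powR_ge0.
  apply: (@le_trans _ _ (\int[sigma]_(y in E k) (c%:E * f y))).
    apply: ae_ge0_le_integral => //; first exact: measurable_funTS.
    - by move=> y _; rewrite mule_ge0// lee_fin.
    - by apply: measurable_funTS; exact: measurable_funeM.
    apply: filterS PhiP => y yP [Dy [_ /negP]]; rewrite -leNgt => by_.
    have [_ gf] := yP Dy.
    have bq0 : (0 < b k `^ q)%R by rewrite powR_gt0.
    have : g y * ((b k) `^ q)%:E <= K%:E * f y.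
      apply: le_trans gf; rewrite lee_wpmul2l// -poweR_EFin.
      by apply: poweR_le => //; rewrite lee_fin ltW.
    rewrite -lee_pdivlMr// => /le_trans; apply.
    by rewrite -powRN /c EFinM muleAC.
  rewrite ge0_integralZl//; last first.
    exact: measurable_funTS.
  have : \int[sigma]_(y in E k) f y <= (b k.+1)%:E.
    apply: le_trans (intSf k.+1); apply: ge0_subset_integral => //.
    - exact: measurableI.
    - exact: measurable_funTS.
    - by move=> y [Dy [Sy _]].
  move/(lee_wpmul2l _) => /(_ c%:E); rewrite lee_fin => /(_ c0) /le_trans; apply.
  have d0 : (0 <= delta)%R := ltW delta0.
  rewrite -EFinM lee_fin /c /b exprS powRM ?exprn_ge0//.
  rewrite -powR_mulrn// powRAC powR_mulrn ?powR_ge0//.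
  have powR1B (x : R) : (0 < x)%R -> (x `^ (1 - q) = x * x `^ (- q))%R.
    by move=> x0; rewrite powRD ?(gt_eqF x0) ?implybT// powRr1// ltW.
  rewrite !powR1B// exprMn powR_mulrn//.
  by rewrite le_eqVlt; apply/orP; left; apply/eqP; ring.
have DE : \int[sigma]_(y in D) g y <= \int[sigma]_(y in \bigcup_k E k) g y.
  have mUE : measurable (\bigcup_k E k) by exact: bigcupT_measurable.
  rewrite [leRHS]integral_mkcond [leLHS]integral_mkcond.
  apply: ae_ge0_le_integral => //.
  - by move=> y _; apply: erestrict_ge0 => z _; exact: g0.
  - by apply/(measurable_restrictT g _).1 => //; exact: measurable_funTS.
  - by move=> y _; apply: erestrict_ge0 => z _; exact: g0.
  - by apply/(measurable_restrictT g _).1 => //; exact: measurable_funTS.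
  apply: filterS PhiP => y yP _.
  rewrite /patch; case: ifPn => [/set_mem Dy|_]; last by case: ifPn.
  rewrite ifT//; apply/mem_set.
  have [Phioo _] := yP Dy.
  have : exists k, S k y.
    have d0 : (0 <= delta)%R := ltW delta0.
    have Phi0 : 0 <= Phi y by rewrite (le_trans _ (Phi_ge y)).
    have Phi_fin : Phi y \is a fin_num by rewrite ge0_fin_numE.
    have bound_ge0 : (0 <= delta^-1 * fine (Phi y))%R.
      by rewrite mulr_ge0 ?fine_ge0// invr_ge0.
    exists (Num.bound (delta^-1 * fine (Phi y))); rewrite /S /=.
    rewrite -[ltLHS]fineK// lte_fin /b -ltr_pdivrMl//.
    apply: (lt_trans (archi_boundP bound_ge0)).
    by rewrite -natrX ltr_nat ltn_expl.
  move=> exS; have exS' : exists k, `[< S k y >] by case: exS => k Sk; exists k; apply/asboolP.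
  (* S 0 is empty since Phi is at least delta, so the stratum is the predecessor
     of the least k with y in S k *)
  case: (ex_minnP exS') => -[|k] /asboolP Sk kmin.
    by move: Sk; rewrite /S /= /b expr0 mulr1 ltNge Phi_ge.
  exists k => //; split=> //; split=> // /asboolP /kmin.
  by rewrite ltnn.
apply: (le_trans DE); rewrite ge0_integral_bigcup//; last first.
  by apply: measurable_funTS.
have two1 : (`|2 `^ (1 - q) : R| < 1)%R.
  by rewrite ger0_norm ?powR_ge0// powR2_onem_lt1.
apply: (@le_trans _ _ (\sum_(0 <= k <oo)
    ((2 * K * delta `^ (1 - q))%R * (2 `^ (1 - q)) ^+ k)%:E)).
  by apply: lee_nneseries => k *; [exact: integral_ge0|exact: intEg].
have := @cvg_geometric_series _ (2 * K * delta `^ (1 - q))%R _ two1.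
move=> gcvg; rewrite -(cvg_lim _ gcvg)// -EFin_lim; last first.
  by apply/cvg_ex; eexists; exact: gcvg.
rewrite le_eqVlt; apply/orP; left; apply/eqP; congr (limn _).
by apply/funext => n /=; rewrite sumEFin.
Qed.

End level_sets.

(** * Superlinear inequalities for a quasi-metric kernel *)

Section quasi_metric_kernel.
Local Open Scope ereal_scope.
Context d (T : measurableType d) (R : realType).
Variables (sigma : {measure set T -> \bar R}) (G : T -> T -> \bar R) (kappa q a : R) (o : T).
Hypotheses (G_gt0 : forall x y, 0 < G x y) (G_sym : forall x y, G x y = G y x).
Hypothesis mG : forall x, measurable_fun [set: T] (G x).
Hypothesis kappa1 : (1 <= kappa)%R.
Hypothesis G_quasi : forall x y z, Order.min (G x y) (G y z) <= kappa%:E * G x z.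
Hypotheses (q1 : (1 < q)%R) (a0 : (0 < a)%R).

Let m x := Order.min (G x o) (a^-1)%:E.
Let B (r : R) := [set y : T | (r^-1)%:E < G o y].

Let G_ge0 x y : 0 <= G x y. Proof. exact: ltW. Qed.
Let kappa_gt0 : (0 < kappa)%R. Proof. exact: lt_le_trans kappa1. Qed.
Let kappa_ge0 : (0 <= kappa)%R. Proof. exact: ltW. Qed.
Let q0 : (0 <= q)%R. Proof. by rewrite ltW// (lt_trans _ q1). Qed.

Let mB r : measurable (B r).
Proof. by rewrite -[B r]setTI; exact: emeasurable_fun_o_infty. Qed.

Let m_gt0 x : 0 < m x.
Proof. by rewrite lt_min G_gt0 lte_fin invr_gt0. Qed.

Let m_le x : m x <= (a^-1)%:E. Proof. by rewrite ge_min lexx orbT. Qed.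

Let m_fin x : m x \is a fin_num.
Proof.
by rewrite ge0_fin_numE ?(ltW (m_gt0 x))// (le_lt_trans (m_le x))// ltry.
Qed.

Let mm : measurable_fun [set: T] m.
Proof.
apply: measurable_mine => //.
by rewrite (_ : (fun x => G x o) = G o)//; apply/funext.
Qed.

Let mmq : measurable_fun [set: T] (fun x => m x `^ q).
Proof. exact: (measurableT_comp (measurable_poweR q) mm). Qed.

Section sufficiency.

(** Let G(x, y) > kappa m(x). Quasi-metricity at o, x, y bounds G(o, y) below by
    m(x) / kappa, so y is in the ball. At x, y, o it shows that m(y) > kappa m(x)
    would force G(x, o) > m(x), hence m(x) = 1 / a, the largest value of m. *)
Lemma kernel_le_or_mem_shell x y :
  G x y <= kappa%:E * m x \/
  B (2 * kappa / fine (m x))%R y /\ m y <= kappa%:E * m x.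
Proof.
have [|xy] := leP (G x y) (kappa%:E * m x); [by left|right].
have mux : m x = (fine (m x))%:E by rewrite fineK.
have mu0 : (0 < fine (m x))%R by rewrite -lte_fin -mux.
have ke0 : 0 <= kappa%:E by rewrite lee_fin.
have m_lekm z : m z <= kappa%:E * m z.
  by rewrite lee_pemull// ltW.
have mxG : m x <= kappa%:E * G o y.
  apply: le_trans (G_quasi o x y); rewrite le_min; apply/andP; split.
    by rewrite G_sym /m ge_min lexx.
  by apply: ltW; apply: le_lt_trans xy.
split.
  rewrite /B /= ltNge; apply/negP => /(lee_wpmul2l ke0) /(le_trans mxG).
  rewrite mux -EFinM lee_fin.
  have -> : (kappa * (2 * kappa / fine (m x))^-1 = fine (m x) / 2)%R.
    by field; rewrite !gt_eqF.
  by move: (fine (m x)) mu0 => t t0; lra.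
rewrite leNgt; apply/negP => ylt.
have : kappa%:E * m x < kappa%:E * G x o.
  apply: lt_le_trans (G_quasi x y o); rewrite lt_min xy.
  by rewrite (lt_le_trans ylt)// ge_min lexx.
rewrite lte_pmul2l//= ?lte_fin// => mxlt.
have mxa : m x = (a^-1)%:E.
  rewrite /m min_r// leNgt; apply/negP => Ga.
  by move: mxlt; rewrite /m min_l ?ltxx// ltW.
have : m x < m y by apply: le_lt_trans ylt.
by rewrite mxa ltNge m_le.
Qed.

(** Split according to the alternative of the preceding lemma. The choice
    r = 2 kappa / m(x) turns the ball condition into a bound by a multiple of
    m(x)^q m(x)^(1 - q). *)
Lemma potential_truncation_le (C : R) : (0 < C)%R ->
  \int[sigma]_x (m x `^ q) < +oo ->
  (forall r x, (a < r)%R -> \int[sigma]_(y in B r) G x y <= (C * r `^ (q - 1))%:E) ->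
  exists2 C' : R, (0 < C')%R &
    forall x, \int[sigma]_y (G x y * m y `^ q) <= C'%:E * m x.
Proof.
move=> C0 intm test.
have intm0 : 0 <= \int[sigma]_x (m x `^ q).
  by apply: integral_ge0 => x _; exact: poweR_ge0.
pose I := fine (\int[sigma]_x (m x `^ q)).
have IE : \int[sigma]_x (m x `^ q) = I%:E by rewrite fineK// ge0_fin_numE.
have I0 : (0 <= I)%R by exact: fine_ge0.
pose C' := (kappa * I + kappa `^ q * (C * (2 * kappa) `^ (q - 1)))%R.
exists C' => [|x].
  rewrite /C' ltr_wpDl ?mulr_ge0// mulr_gt0 ?powR_gt0// mulr_gt0// powR_gt0//.
  by rewrite mulr_gt0.
set mu := fine (m x).
have mux : m x = mu%:E by rewrite fineK.
have mu0 : (0 < mu)%R by rewrite -lte_fin -mux.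
have mu_ge0 := ltW mu0.
(* the near part is bounded through the integral of m^q, its complement through
   the ball condition *)
pose S := [set y | G x y <= (kappa * mu)%:E].
have mS : measurable S.
  by rewrite -[S]setTI; exact: emeasurable_fun_infty_c.
have mGm : measurable_fun [set: T] (fun y => G x y * m y `^ q).
  exact: emeasurable_funM.
have r_gt : (a < 2 * kappa / mu)%R.
  rewrite ltr_pdivlMr//.
  have : (mu <= a^-1)%R by rewrite -lee_fin -mux.
  rewrite -(ler_pM2l a0) mulfV ?gt_eqF// => amu.
  by apply: le_lt_trans amu _; move: kappa1; lra.
have GSC y : ~ S y -> B (2 * kappa / mu)%R y /\ m y <= (kappa * mu)%:E.
  by move=> nS; have [|] := kernel_le_or_mem_shell x y; rewrite -/mu mux// -EFinM.
rewrite -(setUv S) ge0_integral_setU//; last 4 first.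
- exact: measurableC.
- by rewrite setUv.
- by move=> y _; rewrite mule_ge0// poweR_ge0.
- by rewrite disj_set2E setICr.
rewrite mux -EFinM /C' mulrDl EFinD; apply: leeD.
- apply: (@le_trans _ _ (\int[sigma]_(y in S) ((kappa * mu)%:E * m y `^ q))).
    apply: ge0_le_integral => //.
    + by move=> y _; rewrite mule_ge0// poweR_ge0.
    + exact: measurable_funTS.
    + by apply: measurable_funTS; exact: measurable_funeM.
    + by move=> y Sy; rewrite lee_wpmul2r// poweR_ge0.
  rewrite ge0_integralZl//; last 3 first.
  + exact: measurable_funTS.
  + by move=> y _; exact: poweR_ge0.
  + by rewrite lee_fin mulr_ge0.
  have -> : (kappa * I * mu)%:E = (kappa * mu)%:E * I%:E by rewrite -EFinM mulrAC.
  rewrite lee_wpmul2l//.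
    by rewrite lee_fin mulr_ge0.
  rewrite -IE; apply: ge0_subset_integral => // y _; exact: poweR_ge0.
apply: (@le_trans _ _ (\int[sigma]_(y in ~` S) (((kappa * mu) `^ q)%:E * G x y))).
  apply: ge0_le_integral => //.
  + exact: measurableC.
  + by move=> y _; rewrite mule_ge0// poweR_ge0.
  + exact: measurable_funTS.
  + by apply: measurable_funTS; exact: measurable_funeM.
  + move=> y /GSC[_ my]; rewrite muleC lee_wpmul2r// -poweR_EFin.
    by apply: poweR_le => //; exact: ltW.
rewrite ge0_integralZl//; last 3 first.
+ exact: measurableC.
+ exact: measurable_funTS.
+ by rewrite lee_fin powR_ge0.
apply: (@le_trans _ _ (((kappa * mu) `^ q)%:E * (C * (2 * kappa / mu) `^ (q - 1))%:E)).
  rewrite lee_wpmul2l// ?lee_fin ?powR_ge0//; apply: le_trans (test _ x r_gt).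
  apply: ge0_subset_integral => //; first exact: measurableC.
    exact: measurable_funTS.
  by move=> y /GSC[].
rewrite -!EFinM lee_fin.
have muq : (mu `^ q = mu * mu `^ (q - 1))%R.
  by rewrite -mulr_powRB1// (lt_trans _ q1).
rewrite !powRM// ?invr_ge0// ?mulr_ge0// muq -powR_inv1// -powRrM mulN1r powRN.
have : (mu `^ (q - 1) != 0)%R by rewrite gt_eqF// powR_gt0.
move: (mu `^ (q - 1))%R => w w0.
by rewrite le_eqVlt; apply/orP; left; apply/eqP; field.
Qed.


(** The potential is homogeneous of degree q > 1, so the constant C is absorbed by
    the scalar e with e^(q - 1) = 1 / C. *)
Lemma exists_scaled_supersolution (C : R) : (0 < C)%R ->
  (forall x, \int[sigma]_y (G x y * m y `^ q) <= C%:E * m x) ->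
  exists2 e : R, (0 < e)%R &
    forall x, \int[sigma]_y (G x y * (e%:E * m y) `^ q) <= e%:E * m x.
Proof.
move=> C0 Gm; pose e := (C `^ (- (q - 1)^-1))%R.
have e0 : (0 < e)%R by rewrite powR_gt0.
have eq : (e `^ q * C = e)%R.
  rewrite -(@mulr_powRB1 _ e q) ?(ltW e0)// ?(lt_trans _ q1)// /e -powRrM.
  rewrite mulNr mulVf ?gt_eqF ?subr_gt0// -mulrA.
  by rewrite powR_inv1 ?(ltW C0)// mulVf ?gt_eqF// mulr1.
exists e => // x.
under eq_integral => y _.
  rewrite poweRM ?(ltW (m_gt0 y)) ?lee_fin ?(ltW e0)// poweR_EFin muleCA.
  over.
rewrite ge0_integralZl//; last 3 first.
- exact: emeasurable_funM.
- by move=> y _; rewrite mule_ge0// poweR_ge0.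
- by rewrite lee_fin powR_ge0.
apply: (@le_trans _ _ ((e `^ q)%:E * (C%:E * m x))).
  by rewrite lee_wpmul2l// lee_fin powR_ge0.
by rewrite muleA -EFinM eq.
Qed.

End sufficiency.

Section necessity.
Variable v : T -> \bar R.
Hypothesis mv : measurable_fun [set: T] v.
Hypothesis v_pos : {ae sigma, forall x, 0 < v x < +oo}.
Hypothesis v_super : {ae sigma, forall x, \int[sigma]_y (G x y * v y `^ q) <= v x}.

Let mvq : measurable_fun [set: T] (fun x => v x `^ q).
Proof. exact: (measurableT_comp (measurable_poweR q) mv). Qed.

Let vq_ge0 x : 0 <= v x `^ q. Proof. exact: poweR_ge0. Qed.

Let mGv x : measurable_fun [set: T] (fun y => G x y * v y `^ q).
Proof. exact: emeasurable_funM. Qed.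

Let Gv_ge0 x y : 0 <= G x y * v y `^ q.
Proof. exact: mule_ge0. Qed.

Let omega r := \int[sigma]_(y in B r) v y `^ q.

(** For y in the ball of radius r about o, d(x, y) is at most
    kappa max(d(x, o), r), hence at most (kappa r / a) max(d(x, o), a). *)
Lemma kernel_ge_truncation r x y : (a < r)%R -> B r y ->
  (a / (kappa * r))%:E * m x <= G x y.
Proof.
move=> ar By; have r0 : (0 < r)%R by apply: lt_trans ar.
have -> : (a / (kappa * r) = kappa^-1 * (a / r))%R by field; rewrite !gt_eqF.
rewrite EFinM -muleA lee_pdivrMl//; apply: le_trans (G_quasi x o y).
have mx0 := ltW (m_gt0 x).
rewrite le_min; apply/andP; split.
  apply: (@le_trans _ _ (m x)); last by rewrite ge_min lexx.
  by rewrite gee_pMl// lee_fin ler_pdivrMr// mul1r ltW.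
apply: le_trans (ltW By); apply: (@le_trans _ _ ((a / r)%:E * (a^-1)%:E)).
  by rewrite lee_wpmul2l// lee_fin divr_ge0// ltW.
by rewrite -EFinM lee_fin mulrAC mulfV ?gt_eqF// mul1r.
Qed.

Lemma supersolution_ge_truncation r : (a < r)%R ->
  {ae sigma, forall x, (a / (kappa * r))%:E * m x * omega r <= v x}.
Proof.
move=> ar; apply: filterS v_super => x; apply: le_trans.
have r0 : (0 < r)%R by apply: lt_trans ar.
have c0 : 0 <= (a / (kappa * r))%:E * m x.
  by rewrite mule_ge0 ?(ltW (m_gt0 x))// lee_fin divr_ge0 ?mulr_ge0// ltW.
rewrite -ge0_integralZl//; last exact: measurable_funTS.
apply: (@le_trans _ _ (\int[sigma]_(y in B r) (G x y * v y `^ q))).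
  apply: ge0_le_integral => //.
  - by move=> y _; exact: mule_ge0.
  - by apply: measurable_funTS; exact: measurable_funeM.
  - exact: measurable_funTS.
  - by move=> y By; rewrite lee_wpmul2r// kernel_ge_truncation.
exact: ge0_subset_integral.
Qed.

Hypothesis sigma_gt0 : 0 < sigma [set: T].

(** The lower bound for v by m times the energy of the ball must be finite at some
    point. *)
Lemma energy_ball_lty r : (a < r)%R -> omega r < +oo.
Proof.
move=> ar; have r0 : (0 < r)%R by apply: lt_trans ar.
have [x [vx /andP[_ xoo]]] := @ae_exists _ _ _ sigma _ sigma_gt0
  (filterI (supersolution_ge_truncation ar) v_pos).
rewrite ltey; apply/eqP => omegaoo; move: vx.
rewrite omegaoo gt0_muley; last first.
  by rewrite mule_gt0// lte_fin divr_gt0// mulr_gt0.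
by rewrite leNgt xoo.
Qed.

(** The balls exhaust the space because G(o, .) never vanishes. *)
Lemma exists_energy_ball_gt0 : exists2 r, (a < r)%R & 0 < omega r.
Proof.
apply: contrapT => /forall2NP omega_eq0.
have B0 n : sigma (B (a + n.+1%:R)) = 0.
  apply/eqP; rewrite eq_le measure_ge0 andbT leNgt; apply/negP => Bn.
  have [|] := omega_eq0 (a + n.+1%:R)%R; first by rewrite ltrDl.
  apply; apply: ge0_integral_gt0 => //; first exact: measurable_funTS.
  by apply: filterS v_pos => x /andP[x0 _] _; exact: poweR_gt0.
have : sigma (\bigcup_n B (a + n.+1%:R)) = 0.
  apply: measure_negligible; first exact: bigcupT_measurable.
  by apply: negligible_bigcup => n; exists (B (a + n.+1%:R)%R); split.
rewrite (_ : \bigcup_n _ = [set: T]) => [sigma0|].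
  by move: sigma_gt0; rewrite sigma0 ltxx.
apply/seteqP; split=> // y _.
suff [n yn] : exists n, ((a + n.+1%:R)^-1)%:E < G o y by exists n.
have := G_gt0 o y; case: (G o y) => [g|_|//]; last by exists 0%N; exact: ltry.
rewrite lte_fin => g0; exists (Num.bound g^-1).
have gi0 : (0 <= g^-1)%R by rewrite invr_ge0 ltW.
rewrite lte_fin invf_plt ?posrE// ?addr_gt0//.
apply: (lt_trans (archi_boundP gi0)).
by rewrite -natr1 addrA addrAC ltrDr addr_gt0.
Qed.

Lemma exists_truncation_minorant : exists2 c : R, (0 < c)%R &
  {ae sigma, forall x, c%:E * m x <= v x}.
Proof.
have [r ar omega0] := exists_energy_ball_gt0.
have r0 : (0 < r)%R by apply: lt_trans ar.
have omega_fin : omega r \is a fin_num by rewrite ge0_fin_numE ?energy_ball_lty// ltW.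
exists (a / (kappa * r) * fine (omega r))%R.
  by rewrite mulr_gt0 ?divr_gt0 ?mulr_gt0// fine_gt0// omega0 energy_ball_lty.
apply: filterS (supersolution_ge_truncation ar) => x; apply: le_trans.
by rewrite EFinM fineK// muleAC.
Qed.

(** Fix x and grow the ball from the points farthest from x inwards. For z at
    least as far from x as y one has G(x, z) <= kappa G(y, z), so that the
    inequality for v at y bounds from below v(y) by the part of the integral of
    G(x, .) v^q already reached; the floor v >= c / r on the ball supplies the
    starting value of the growth. Only points y of the ball enter through v, so
    the bound holds at every x although v is controlled almost everywhere. *)
Lemma potential_ball_le : exists2 C : R, (0 < C)%R &
  forall r x, (a < r)%R -> \int[sigma]_(y in B r) G x y <= (C * r `^ (q - 1))%:E.
Proof.
have [c c0 cv] := exists_truncation_minorant.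
pose gq : R := (1 - 2 `^ (1 - q))%R.
have gq0 : (0 < gq)%R.
  by rewrite subr_gt0 powR2_onem_lt1.
exists (2 * (2 * kappa) `^ q * (kappa * c) `^ (1 - q) / gq)%R.
  by rewrite divr_gt0// !mulr_gt0// powR_gt0// mulr_gt0.
move=> r x ar; have r0 : (0 < r)%R by apply: lt_trans ar.
(* the starting value that makes v at least Phi / (2 kappa) on the ball *)
pose delta := (kappa * c / r)%R.
have delta0 : (0 < delta)%R by rewrite divr_gt0// mulr_gt0.
have K0 : (0 <= (2 * kappa) `^ q)%R by exact: powR_ge0.
have -> : (2 * (2 * kappa) `^ q * (kappa * c) `^ (1 - q) / gq * r `^ (q - 1) =
    2 * (2 * kappa) `^ q * delta `^ (1 - q) / gq)%R.
  rewrite /delta [((kappa * c / r) `^ _)%R]powRM ?invr_ge0 ?mulr_ge0 ?(ltW c0) ?(ltW r0)//.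
  rewrite -[(r^-1)%R]powR_inv1 ?(ltW r0)// -powRrM mulN1r opprB; ring.
apply: (@integral_le_of_superlinear_growth _ _ _ _ (G x) _ (B r) (fun y => G x y * v y `^ q)) => //.
apply: filterS2 (filterI v_pos v_super) cv => y [/andP[vy0 vyoo] vy] cvy By.
set Phi := _ + _.
have PhiE : Phi <= (2 * kappa)%:E * v y.
  rewrite mulrDl mul1r EFinD ge0_muleDl ?lee_fin//; apply: leeD.
    rewrite /delta -mulrA EFinM lee_wpmul2l ?lee_fin//.
    apply: le_trans cvy; rewrite EFinM lee_wpmul2l ?lee_fin ?(ltW c0)//.
    rewrite le_min lee_fin lef_pV2 ?posrE// (ltW ar) andbT G_sym; exact: ltW.
  apply: (@le_trans _ _ (\int[sigma]_(z in B r `&` [set z | G x z <= G x y])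
                           (kappa%:E * (G y z * v z `^ q)))).
    have mS : measurable (B r `&` [set z | G x z <= G x y]).
      by apply: measurableI => //; exact: measurable_sublevel.
    apply: ge0_le_integral => //.
    - exact: measurable_funTS.
    - by apply: measurable_funTS; exact: measurable_funeM.
    - move=> z [_ /= zy]; rewrite muleA lee_wpmul2r//.
      apply: le_trans (G_quasi y x z); rewrite le_min lexx andbT.
      by rewrite (G_sym y x).
  rewrite ge0_integralZl//; last 2 first.
  - by apply: measurableI => //; exact: measurable_sublevel.
  - exact: measurable_funTS.
  rewrite lee_wpmul2l ?lee_fin//; apply: le_trans vy.
  apply: ge0_subset_integral => //.
  by apply: measurableI => //; exact: measurable_sublevel.
have Phi0 : 0 <= Phi.
  by rewrite adde_ge0 ?lee_fin ?(ltW delta0)// integral_ge0.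
split; first by apply: le_lt_trans PhiE _; rewrite lte_mul_pinfty ?lee_fin ?mulr_ge0.
rewrite muleCA lee_wpmul2l// -poweR_EFin -poweRM ?lee_fin ?mulr_ge0 ?(ltW vy0)//.
exact: poweR_le.
Qed.

(** Inside a ball m^q is dominated by a multiple of v^q. Outside, m = G(., o), and
    the integral of v^q is followed from o outwards: for z nearer to o than y, G(y, z) is at least
    G(o, y) / kappa, so v(y) is at least G(o, y) / kappa times the integral of
    v^q up to the level of y, which starts from the positive energy of the ball. *)
Lemma integral_truncation_lty : \int[sigma]_x m x `^ q < +oo.
Proof.
have [c c0 cv] := exists_truncation_minorant.
have [r ar omega0] := exists_energy_ball_gt0.
have r0 : (0 < r)%R by apply: lt_trans ar.
have omega_fin : omega r \is a fin_num by rewrite ge0_fin_numE ?energy_ball_lty// ltW.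
have mCB : measurable (~` B r) by exact: measurableC.
rewrite -(setUv (B r)) ge0_integral_setU//; last 3 first.
- by rewrite setUv.
- by move=> y _; exact: poweR_ge0.
- by rewrite disj_set2E setICr.
apply: lte_add_pinfty.
  apply: (@le_lt_trans _ _ (\int[sigma]_(y in B r) ((c^-1 `^ q)%:E * v y `^ q))).
    apply: ae_ge0_le_integral => //.
    - by move=> y _; exact: poweR_ge0.
    - exact: measurable_funTS.
    - by move=> y _; rewrite mule_ge0// lee_fin powR_ge0.
    - by apply: measurable_funTS; exact: measurable_funeM.
    apply: filterS2 v_pos cv => y /andP[vy0 _] cvy _.
    have ci0 : (0 <= c^-1)%R by rewrite invr_ge0 ltW.
    rewrite -poweR_EFin -poweRM ?lee_fin ?(ltW vy0)//.
    by apply: poweR_le => //; rewrite ?(ltW (m_gt0 y))// lee_pdivlMl.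
  rewrite ge0_integralZl//; last 2 first.
  - exact: measurable_funTS.
  - by rewrite lee_fin powR_ge0.
  by rewrite lte_mul_pinfty ?lee_fin ?powR_ge0// energy_ball_lty.
apply: (@le_lt_trans _ _ (\int[sigma]_(y in ~` B r) (G o y `^ q))).
  apply: ge0_le_integral => //.
  - by move=> y _; exact: poweR_ge0.
  - exact: measurable_funTS.
  - by apply: measurable_funTS; exact: (measurableT_comp (measurable_poweR q)).
  move=> y _; apply: poweR_le => //; first exact: ltW.
  by rewrite G_sym ge_min lexx.
pose delta := fine (omega r).
have delta0 : (0 < delta)%R by rewrite fine_gt0// omega0 energy_ball_lty.
apply: le_lt_trans (ltry _).
apply: (@integral_le_of_superlinear_growth _ _ _ _ (fun y => - G o y) _ (~` B r)
  (fun y => v y `^ q) _ _ _ _ q delta (kappa `^ q)%R) => //.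
- exact: measurableT_comp.
- by apply: (measurableT_comp (measurable_poweR q)).
- by move=> y; exact: poweR_ge0.
- exact: powR_ge0.
apply: filterS2 v_pos v_super => y /andP[vy0 vyoo] vy nBy.
set S := [set z | - G o z <= - G o y].
have mS : measurable S.
  by apply: (@measurable_sublevel _ _ _ (fun z => - G o z)); exact: measurableT_comp.
(* delta is the energy of the ball, so Phi is a single integral over the ball
   together with the points of the complement up to the level of y *)
have -> : delta%:E + \int[sigma]_(z in ~` B r `&` S) v z `^ q =
    \int[sigma]_(z in B r `|` (~` B r `&` S)) v z `^ q.
  rewrite ge0_integral_setU//; first by rewrite fineK.
  - exact: measurableI.
  - exact: measurable_funTS.
  - by rewrite disj_set2E setIA setICr set0I.
set W := B r `|` _; have mW : measurable W by apply: measurableU => //; exact: measurableI.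
set Phi := \int[sigma]_(z in W) _.
have Phi0 : 0 <= Phi by exact: integral_ge0.
have GPhi : G o y * Phi <= kappa%:E * v y.
  rewrite -ge0_integralZl//; last exact: measurable_funTS.
  apply: (@le_trans _ _ (\int[sigma]_(z in W) (kappa%:E * (G y z * v z `^ q)))).
    apply: ge0_le_integral => //.
    - by move=> z _; exact: mule_ge0.
    - by apply: measurable_funTS; exact: measurable_funeM.
    - by apply: measurable_funTS; exact: measurable_funeM.
    move=> z Wz; rewrite muleA lee_wpmul2r//.
    apply: le_trans (G_quasi y o z); rewrite le_min (G_sym y o) lexx /=.
    case: Wz => [Bz|[_ Sz]]; last by rewrite -leeN2; exact: Sz.
    by rewrite ltW// (le_lt_trans _ Bz)// leNgt; apply/negP.
  rewrite ge0_integralZl//; last exact: measurable_funTS.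
  rewrite lee_wpmul2l ?lee_fin//; apply: le_trans vy.
  exact: ge0_subset_integral.
split.
  rewrite ltey; apply/eqP => Phioo; move: GPhi.
  rewrite Phioo gt0_muley// leNgt => /negP; apply.
  by rewrite lte_mul_pinfty ?lee_fin.
rewrite -poweR_EFin -!poweRM ?lee_fin ?(ltW vy0)//.
by apply: poweR_le => //; exact: mule_ge0.
Qed.

End necessity.
End quasi_metric_kernel.

(** * Borel sets and the Riemannian measure *)

(** The determinant does not vanish on the segment from the identity to A, which
    consists of positive definite matrices, and is a polynomial along it. *)
Lemma det_gt0_of_pos_def (R : rcfType) (n : nat) (A : 'M[R]_n) :
  (forall w : 'rV[R]_n, w != 0 -> 0 < (w *m A *m w^T) 0 0) -> 0 < \det A.
Proof.
move=> Apos.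
pose S (t : R) : 'M[R]_n := (1 - t)%:M + t *: A.
have S_det_neq0 t : 0 <= t <= 1 -> \det (S t) != 0.
  move=> /andP[t0 t1]; apply/negP => /det0P[w w0 wS].
  have : 0 < (w *m S t *m w^T) 0 0.
    rewrite mulmxDr mulmxDl mxE mul_mx_scalar -scalemxAl -scalemxAr -scalemxAl.
    have ww : 0 < (w *m w^T) 0 0.
      rewrite mxE; have /rV0Pn[j wj] := w0.
      rewrite (bigD1 j)//= mxE ltr_wpDr//; last by rewrite -expr2 exprn_even_gt0.
      by apply: sumr_ge0 => k _; rewrite mxE -expr2 sqr_ge0.
    rewrite [X in X + _]mxE [X in _ + X]mxE.
    have [->|t_neq0] := eqVneq t 0; first by rewrite subr0 mul1r mul0r addr0.
    rewrite ltr_wpDl//; first by rewrite mulr_ge0 ?subr_ge0// ltW.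
    by rewrite mulr_gt0 ?Apos// lt_def t_neq0.
  by rewrite wS mul0mx mxE ltxx.
pose P : {poly R} := \det ((1 - 'X)%:M + 'X *: map_mx polyC A).
have PE t : P.[t] = \det (S t).
  rewrite -[P.[t]]/(horner_eval t P) -det_map_mx; congr (\det _).
  apply/matrixP => i j; rewrite !mxE /= /horner_eval.
  by rewrite !hornerE hornerMn !hornerE.
rewrite ltNge; apply/negP => detA.
have P0 : 0 < P.[0] by rewrite PE /S subr0 scale0r addr0 det1.
have P1 : P.[1] <= 0 by rewrite PE /S subrr scale1r raddf0 add0r.
have [t t01] : exists2 t, 0 <= t <= 1 & root (- P) t.
  by apply: poly_ivt => //; rewrite !hornerN oppr_le0 oppr_ge0 (ltW P0) P1.
by rewrite rootN => /rootP; rewrite PE => /eqP; apply/negP; exact: S_det_neq0.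
Qed.

Lemma continuous_det (R : realType) (n : nat) :
  continuous (fun A : 'M[R]_n => \det A : R).
Proof.
rewrite /determinant; apply: (@continuous_big R^o _ +%R 0 xpredT) => [|s _ A].
  exact: add_continuous.
have prod_cvg : (\prod_i x i (s i) : R) @[x --> A] --> (\prod_i A i (s i) : R).
  apply: (@cvg_big R^o _ *%R 1 xpredT); first exact: mul_continuous.
  by move=> i _; exact: coord_continuous.
exact: (cvgM (cvg_cst ((-1) ^+ s : R)) prod_cvg).
Qed.

Section borel.
Context {X Y : ptopologicalType}.

Lemma open_measurable_borel (A : set X) : open A -> measurable (A : set (borel X)).
Proof. exact: sub_sigma_algebra. Qed.

Lemma open_setI_preimage (D : set X) (f : X -> Y) (O : set Y) : open D ->
  (forall x, D x -> {for x, continuous f}) -> open O -> open (D `&` f @^-1` O).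
Proof.
move=> oD cf oO; rewrite openE => x [Dx Ox].
apply: filterI; first exact: open_nbhs_nbhs.
by apply: cf => //; exact: open_nbhs_nbhs.
Qed.

Lemma measurable_preimage_borel (D : set X) (f : X -> Y) (K : set (borel Y)) : open D ->
  (forall x, D x -> {for x, continuous f}) -> measurable K ->
  measurable (D `&` f @^-1` K : set (borel X)).
Proof.
move=> oD cf; have : measurable_fun (D : set (borel X)) (f : borel X -> borel Y).
  apply: (@measurability _ _ (borel X) (borel Y) D f (@open Y)) => //.
  by move=> _ [V oV <-]; apply: open_measurable_borel; exact: open_setI_preimage.
by move=> mf; apply: mf; exact: open_measurable_borel.
Qed.

End borel.

Lemma measurable_box (R : realType) (n : nat) (a b : 'rV[R]_n) :
  measurable ([set v | forall i, a 0 i < v 0 i <= b 0 i] : set (borel 'rV[R]_n)).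
Proof.
rewrite (_ : mkset _ = \bigcap_(i in [set: 'I_n])
    ([set v | a 0 i < v 0 i] `&` ~` [set v | b 0 i < v 0 i])); last first.
  apply/seteqP; split=> v /= => [vab i _|vab i]; last first.
    by have [-> /= /negP] := vab i I; rewrite -leNgt.
  by have /andP[av vb] := vab i; split => //=; apply/negP; rewrite -leNgt.
have o_gt (c : R) i : open [set v : 'rV[R]_n | c < v 0 i].
  apply: (@open_comp _ R^o (fun v : 'rV[R]_n => v 0 i) [set x | c < x]).
    by move=> v _; exact: coord_continuous.
  exact: open_gt.
apply: fin_bigcap_measurable => // i _; apply: measurableI.
  exact: (open_measurable_borel (o_gt _ _)).
by apply: measurableC; exact: (open_measurable_borel (o_gt _ _)).
Qed.


Lemma measurable_fun_of_superlevels (X : ptopologicalType) (R : realType)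
    (D : set (borel X)) (f : borel X -> \bar R) :
  (forall a : R, measurable (D `&` [set x | (a%:E < f x)%E])) -> measurable_fun D f.
Proof.
move=> mDf; apply: (measurability _ (ErealGenOInfty.measurableE R)).
by move=> /= _ [_ [a ->]] <-; rewrite preimage_itvoy; exact: mDf.
Qed.

Section riemannian_measure.
Context {R : realType} {n : nat} {M : ptopologicalType}.
Variable g : riemannian_manifold R n M.
Variable mu : {measure set (borel M) -> \bar R}.
Hypothesis mu_riemannian : is_riemannian_measure g mu.

Lemma volume_density_gt0 c v : atlas g c -> cimg c v -> 0 < volume_density g c v.
Proof.
move=> ac cv; rewrite sqrtr_gt0 det_gt0_of_pos_def// => w w0.
exact: gram_pos.
Qed.

Lemma volume_density_continuous c v : atlas g c -> cimg c v ->
  {for v, continuous (volume_density g c : 'rV[R]_n -> R^o)}.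
Proof.
move=> ac cv; apply: (@continuous_comp _ R^o R^o (fun v => \det (gram g c v)) Num.sqrt).
  apply: (@continuous_comp _ _ R^o (gram g c) (fun A => \det A)).
    by have [+ _] := gram_smooth ac 0; exact.
  exact: continuous_det.
exact: sqrt_continuous.
Qed.

(** In a chart the density is continuous and positive, hence pinched between two
    positive constants on a small box. Half-open boxes are the sets whose Lebesgue
    measure is prescribed. *)
Lemma exists_small_measurable_nbhd (x : M) (N : set M) : nbhs x N ->
  exists U : set (borel M), [/\ measurable U, U `<=` N, (0 < mu U)%E & (mu U < +oo)%E].
Proof.
move=> xN; have [lam lebesgue_lam muE] := mu_riemannian.
pose c := chart_at g x; have ac : atlas g c by exact: chart_at_atlas.
have [oD oI cK cmap_cont cinv_cont] := atlas_chart ac.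
have cx : cdom c x by exact: chart_at_dom.
pose v0 := cmap c x; have Iv0 : cimg c v0 by exists x.
pose rho := volume_density g c; have rho0 : 0 < rho v0 by exact: volume_density_gt0.
have rho_cont v : cimg c v -> {for v, continuous (rho : 'rV[R]_n -> R^o)}.
  exact: volume_density_continuous.
have /nbhs_ballP[e /= e0 eW] : nbhs v0
    ((cimg c `&` cinv c @^-1` N) `&` rho @^-1` `]rho v0 / 2, 2 * rho v0[).
  apply: filterI; first apply: filterI.
  - exact: open_nbhs_nbhs.
  - by apply: cinv_cont => //; rewrite /v0 cK.
  - apply: rho_cont => //; apply: near_in_itvoo; rewrite in_itv/=.
    by apply/andP; split; lra.
pose a := v0 - const_mx (e / 2); pose b := v0 + const_mx (e / 2).
pose K := [set v : 'rV[R]_n | forall i, a 0 i < v 0 i <= b 0 i].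
have KW v : K v -> [/\ cimg c v, N (cinv c v) & rho v0 / 2 < rho v < 2 * rho v0].
  move=> Kv; suff /eW[[? ?] /=] : ball v0 e v by rewrite in_itv/=; split.
  split=> // i j; rewrite (ord1 i) /ball/=; have := Kv j; rewrite /a /b !mxE ltr_norml.
  by move=> /andP[? ?]; apply/andP; split; lra.
have mK : measurable (K : set (borel 'rV[R]_n)) by exact: measurable_box.
pose U : set (borel M) := cdom c `&` cmap c @^-1` K.
have mU : measurable U by exact: measurable_preimage_borel.
have cU : cmap c @` U = K.
  apply/seteqP; split=> [_ [y [_ Ky] <-]//|v Kv].
  by have [[y cy yv] _ _] := KW _ Kv; exists y => //; split=> //=; rewrite yv.
have lamK : lam K = (\prod_(i < n) e)%:E.
  rewrite lebesgue_lam => [|i]; last by rewrite /a /b !mxE; lra.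
  by congr EFin; apply: eq_bigr => i _; rewrite /a /b !mxE; lra.
have prod0 : 0 < \prod_(i < n) e by apply: prodr_gt0.
have mrho : measurable_fun (K : set (borel 'rV[R]_n)) (fun v => (rho v)%:E).
  apply: (@measurable_funS _ _ _ _ (cimg c : set (borel 'rV[R]_n))).
  - exact: open_measurable_borel.
  - by move=> v /KW[].
  apply: measurable_fun_of_superlevels => r; apply: open_measurable_borel.
  rewrite (_ : [set v | _] = rho @^-1` [set y | r < y]); last first.
    by apply/seteqP; split=> v /=; rewrite lte_fin.
  exact: (@open_setI_preimage _ R^o _ rho [set y | r < y] oI rho_cont (@open_gt _ r)).
have muU : mu U = (\int[lam]_(v in K) (rho v)%:E)%E.
  by rewrite (muE c)// ?cU// => y [].
exists U; split => //.
- by move=> y [cy /= /KW[_]]; rewrite cK.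
- rewrite muU; apply: (@lt_le_trans _ _ ((rho v0 / 2)%:E * lam K)%E).
    by rewrite lamK -EFinM lte_fin mulr_gt0// divr_gt0.
  rewrite -integral_cst//; apply: ge0_le_integral => //.
  + by move=> v _; rewrite lee_fin divr_ge0// ltW.
  + by move=> v /KW[_ _ /andP[+ _]]; rewrite lee_fin => /ltW.
rewrite muU; apply: (@le_lt_trans _ _ ((2 * rho v0)%:E * lam K)%E).
  rewrite -integral_cst//; apply: ge0_le_integral => //.
  + by move=> v /KW[Iv _ _]; rewrite lee_fin ltW// volume_density_gt0.
  + by move=> v /KW[_ _ /andP[_ +]]; rewrite lee_fin => /ltW.
by rewrite lamK -EFinM ltry.
Qed.

End riemannian_measure.

(** * Continuity and symmetry of the heat kernel *)

Section heat_kernel.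
Context {R : realType} {n : nat} {M : ptopologicalType}.
Variables (g : riemannian_manifold R n M) (mu : {measure set (borel M) -> \bar R}).
Variable p : R -> M -> M -> R.

Section continuity.
Hypothesis p_smooth : smooth_kernel g p.

(** Smoothness gives continuity of the coordinate expression; near (x, y) the
    kernel is its composition with the two charts. *)
Lemma heat_kernel_cvg t x y : 0 < t ->
  p z.1 z.2.1 z.2.2 @[z --> ((t : R^o), (x, y))] --> (p t x y : R^o).
Proof.
move=> t0; pose c := chart_at g x; pose d := chart_at g y.
have [oc _ cK cmap_cont _] := atlas_chart (chart_at_atlas g x : atlas g c).
have [od _ dK dmap_cont _] := atlas_chart (chart_at_atlas g y : atlas g d).
have cx : cdom c x by exact: chart_at_dom.
have dy : cdom d y by exact: chart_at_dom.
have [+ _] := p_smooth (chart_at_atlas g x) (chart_at_atlas g y) 0.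
move=> /(_ ((t : R^o), (cmap c x, cmap d y))); rewrite /= => F_cont.
have {}F_cont := F_cont (And3 t0 (ex_intro2 _ _ x cx erefl) (ex_intro2 _ _ y dy erefl)).
pose z0 : R^o * (M * M) := (t, (x, y)).
have snd_cvg : z.2 @[z --> z0] --> (x, y) by exact: cvg_snd.
have c_cvg : cmap c z.2.1 @[z --> z0] --> cmap c x.
  have fst_cvg : z.2.1 @[z --> z0] --> x.
    by apply: (cvg_comp _ _ snd_cvg); exact: cvg_fst.
  have c_at : cmap c @ x --> cmap c x := cmap_cont _ cx.
  exact: (cvg_comp _ _ fst_cvg c_at).
have d_cvg : cmap d z.2.2 @[z --> z0] --> cmap d y.
  have snd_snd_cvg : z.2.2 @[z --> z0] --> y.
    by apply: (cvg_comp _ _ snd_cvg); exact: cvg_snd.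
  have d_at : cmap d @ y --> cmap d y := dmap_cont _ dy.
  exact: (cvg_comp _ _ snd_snd_cvg d_at).
have t_cvg : z.1 @[z --> z0] --> (t : R^o) by exact: cvg_fst.
have cd_cvg : (cmap c z.2.1, cmap d z.2.2) @[z --> z0] --> (cmap c x, cmap d y).
  exact: cvg_pair c_cvg d_cvg.
have psi_cvg : (z.1, (cmap c z.2.1, cmap d z.2.2)) @[z --> z0] -->
    ((t : R^o), (cmap c x, cmap d y)).
  exact: cvg_pair t_cvg cd_cvg.
have := cvg_comp _ _ psi_cvg F_cont; rewrite /= cK// dK// => compF.
apply: cvg_trans compF; apply: near_eq_cvg.
have cN : nbhs x (cdom c) by exact: open_nbhs_nbhs.
have dN : nbhs y (cdom d) by exact: open_nbhs_nbhs.
have : nbhs ((t : R^o), (x, y)) [set z | cdom c z.2.1 /\ cdom d z.2.2].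
  exists ([set: R^o], cdom c `*` cdom d) => /=.
    by split; [exact: filterT|exists (cdom c, cdom d)].
  by move=> z [_ []].
by apply: filterS => z [cz dz] /=; rewrite cK// dK.
Qed.

End continuity.

Lemma L2_indic (U : set (borel M)) : measurable U -> (mu U < +oo)%E -> L2 mu (\1_U).
Proof.
move=> mU Uoo; rewrite /L2 inE; apply/andP; split; rewrite inE/=.
  exact: measurable_indic.
rewrite /finite_norm unlock; apply: poweR_lty.
apply: le_lt_trans Uoo; rewrite -[X in (_ <= mu X)%E](setIT U) -integral_indic//.
apply: ge0_le_integral => //.
- by move=> y _; exact: poweR_ge0.
- apply: (measurableT_comp (measurable_poweR _)); apply: measurableT_comp => //.
  by apply/measurable_EFinP; exact: measurable_indic.
- by apply/measurable_EFinP; exact: measurable_indic.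
- move=> y _ /=; rewrite indicE; case: (_ \in _) => /=.
    by rewrite normr1 powR1.
  by rewrite normr0 powR0.
Qed.

Lemma integrable_indic_finite (U : set (borel M)) : measurable U -> (mu U < +oo)%E ->
  mu.-integrable [set: borel M] (EFin \o \1_U).
Proof.
move=> mU Uoo; apply/integrableP; split.
  by apply/measurable_EFinP; exact: measurable_indic.
under eq_integral => y _ do rewrite /= ger0_norm ?indicE//.
by under eq_integral => y _ do rewrite -indicE; rewrite integral_indic// setIT.
Qed.

Lemma Rintegral_indicZ (U : set (borel M)) (b : R) : measurable U -> (mu U < +oo)%E ->
  \int[mu]_(y in [set: borel M]) (b * \1_U y) = b * fine (mu U).
Proof.
move=> mU Uoo; rewrite RintegralZl//; last exact: integrable_indic_finite.
by rewrite /Rintegral integral_indic// setIT.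
Qed.

Hypothesis p_heat : is_heat_kernel g mu p.

Lemma exists_symmetric_semigroup : exists P : R -> (M -> R) -> M -> R,
  [/\ forall t f, 0 <= t -> L2 mu f -> L2 mu (P t f),
      forall t f h, 0 <= t -> L2 mu f -> L2 mu h ->
        L2inner mu (P t f) h = L2inner mu f (P t h) &
      forall t f, 0 < t -> L2 mu f ->
        {ae mu, forall x,
           mu.-integrable [set: borel M] (fun y => (p t x y * f y)%:E) /\
           P t f x = \int[mu]_(y in [set: borel M]) (p t x y * f y)}].
Proof.
have [A [P [_ sgP _ _ PE]]] := p_heat.
by exists P; split=> //; [exact: sg_L2 sgP|exact: sg_symmetric sgP].
Qed.

(** The inner integral is bounded pointwise on V, which estimates the iterated
    integral in the order in which it is written. *)
Lemma kernel_operator_pairing_bounds (P : (M -> R) -> M -> R) (k : M -> M -> R)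
    (U V : set (borel M)) (b1 b2 : R) :
  measurable U -> measurable V -> (mu U < +oo)%E -> (mu V < +oo)%E ->
  L2 mu (P \1_U) ->
  {ae mu, forall x,
     mu.-integrable [set: borel M] (fun y => (k x y * \1_U y)%:E) /\
     P \1_U x = \int[mu]_(y in [set: borel M]) (k x y * \1_U y)} ->
  (forall x y, V x -> U y -> b1 <= k x y <= b2) ->
  b1 * fine (mu U) * fine (mu V) <= L2inner mu (P \1_U) \1_V <=
  b2 * fine (mu U) * fine (mu V).
Proof.
move=> mU mV Uoo Voo L2P PE kb.
have iPV : mu.-integrable [set: borel M] (EFin \o (P \1_U \* \1_V)).
  by apply/Lfun1_integrable; apply: Lfun2_mul_Lfun1 => //; exact: L2_indic.
have icst b (W : set (borel M)) : measurable W -> (mu W < +oo)%E ->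
    mu.-integrable [set: borel M] (EFin \o (fun y => b * \1_W y)).
  move=> mW Woo; rewrite (_ : EFin \o _ = fun y => (b%:E * (\1_W y)%:E)%E)//.
  by apply: integrableZl => //; exact: integrable_indic_finite.
have Pb : {ae mu, forall x, V x ->
    b1 * fine (mu U) <= P \1_U x <= b2 * fine (mu U)}.
  apply: (ae_imply PE) => x [ik ->] Vx; rewrite -!Rintegral_indicZ//.
  apply/andP; split; apply: le_Rintegral => //; try exact: icst.
  - move=> y _; rewrite indicE; case: (boolP (y \in U)) => [/set_mem Uy|_].
      by rewrite !mulr1; case/andP: (kb _ _ Vx Uy).
    by rewrite !mulr0.
  - move=> y _; rewrite indicE; case: (boolP (y \in U)) => [/set_mem Uy|_].
      by rewrite !mulr1; case/andP: (kb _ _ Vx Uy).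
    by rewrite !mulr0.
rewrite /L2inner -!(Rintegral_indicZ (_ * fine (mu U)) mV Voo).
apply/andP; split; apply: ae_le_Rintegral => //; try exact: icst.
- apply: (ae_imply Pb) => x Pbx; rewrite indicE; case: (boolP (x \in V)) => [/set_mem Vx|_].
    by rewrite !mulr1; case/andP: (Pbx Vx).
  by rewrite !mulr0.
- apply: (ae_imply Pb) => x Pbx; rewrite indicE; case: (boolP (x \in V)) => [/set_mem Vx|_].
    by rewrite !mulr1; case/andP: (Pbx Vx).
  by rewrite !mulr0.
Qed.

Hypothesis mu_riemannian : is_riemannian_measure g mu.

(** Otherwise, by continuity, the kernel on a neighbourhood of (x, y) exceeds by a
    fixed amount its values on the reflected neighbourhood. Pairing the indicators
    of two small sets through the semigroup in both orders contradicts its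
    symmetry. *)
Lemma heat_kernel_le_sym t x y : 0 < t -> p t x y <= p t y x.
Proof.
move=> t0; have [_ [_ [_ _ p_smooth _ _]]] := p_heat.
rewrite leNgt; apply/negP => pyx.
(* a third of the gap, so that the two ranges of values stay disjoint *)
pose e := (p t x y - p t y x) / 3; have e0 : 0 < e by rewrite divr_gt0// subr_gt0.
have near_p x1 y1 : exists2 A : set M * set M, nbhs x1 A.1 /\ nbhs y1 A.2 &
    forall x' y', A.1 x' -> A.2 y' -> p t x1 y1 - e <= p t x' y' <= p t x1 y1 + e.
  have /(_ _ (nbhsx_ballx _ _ e0)) := @heat_kernel_cvg p_smooth t x1 y1 t0.
  move=> [[T A] /= [tT [[A1 A2] /= [xA1 yA2] A12]] TA].
  exists (A1, A2) => //= x' y' Ax Ay.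
  have := TA (t, (x', y')) (conj (nbhs_singleton tT) (A12 (x', y') (conj Ax Ay))).
  by rewrite /= /ball/= ltr_distlC => /andP[? ?]; apply/andP; split; lra.
have [[A1 A2] /= [xA1 yA2] pA] := near_p x y.
have [[B2 B1] /= [yB2 xB1] pB] := near_p y x.
have [U [mU UN U0 Uoo]] := exists_small_measurable_nbhd mu_riemannian (filterI xA1 xB1).
have [V [mV VN V0 Voo]] := exists_small_measurable_nbhd mu_riemannian (filterI yA2 yB2).
have [P [P_L2 P_sym PE]] := exists_symmetric_semigroup.
have LU := L2_indic mU Uoo; have LV := L2_indic mV Voo.
have /andP[_ UV] := kernel_operator_pairing_bounds (P := P t) mU mV Uoo Voo (P_L2 _ _ (ltW t0) LU)
  (PE _ _ t0 LU) (fun x' y' Vx Uy => pB x' y' (VN _ Vx).2 (UN _ Uy).2).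
have /andP[VU _] := kernel_operator_pairing_bounds (P := P t) mV mU Voo Uoo (P_L2 _ _ (ltW t0) LV)
  (PE _ _ t0 LV) (fun x' y' Ux Vy => pA x' y' (UN _ Ux).1 (VN _ Vy).1).
have pairing_sym : L2inner mu (P t \1_V) \1_U = L2inner mu (P t \1_U) \1_V.
  rewrite P_sym ?(ltW t0)// /L2inner; apply: eq_Rintegral => z _; exact: mulrC.
move: VU; rewrite pairing_sym => /le_trans /(_ UV).
rewrite -!mulrA [fine (mu V) * _]mulrC ler_pM2r; last first.
  by rewrite mulr_gt0// fine_gt0// ?U0 ?V0.
by rewrite /e; lra.
Qed.

Lemma heat_kernel_sym t x y : 0 < t -> p t x y = p t y x.
Proof. by move=> t0; apply/eqP; rewrite eq_le !heat_kernel_le_sym. Qed.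

End heat_kernel.

(** * The constant of the Green kernel *)

Section gamma.
Context {R : realType}.
Implicit Types (a s : R).

Lemma powR_continuous_at a s : 0 < s -> {for s, continuous (fun t : R => t `^ a)}.
Proof.
move=> s0; apply: differentiable_continuous; apply/derivable1_diffP.
by have [] := is_derive1_powR a s0.
Qed.

(** On [1 / n, 1] a primitive bounds the integral by 1 / a; let n tend to
    infinity. *)
Lemma integral_powR_lty a : 0 < a ->
  (\int[lebesgue_measure]_(s in `]0%R, 1%R]) (s `^ (a - 1))%:E < +oo :> \bar R)%E.
Proof.
move=> a0; pose F n := `[n.+2%:R^-1 : R, 1]%classic.
(* n.+2 makes every interval nondegenerate *)
have F_le n : (\int[lebesgue_measure]_(s in F n) (s `^ (a - 1))%:E <= (a^-1)%:E :> \bar R)%E.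
  have n1 : n.+2%:R^-1 < 1 :> R by rewrite invf_lt1// ltr1n.
  have n0 : 0 < n.+2%:R^-1 :> R by rewrite invr_gt0.
  pose Fa (s : R) : R := a^-1 * s `^ a.
  have dFa s : 0 < s -> is_derive s 1 Fa (s `^ (a - 1)).
    move=> s0; have := is_derive1_powR a s0 => dpow.
    rewrite (_ : s `^ (a - 1) = a^-1 *: (a * s `^ (a - 1))); last first.
      by rewrite /GRing.scale/= mulrA mulVf ?mul1r// gt_eqF.
    exact: is_deriveZ.
  have Fa_cont s : 0 < s -> {for s, continuous Fa}.
    move=> s0; apply: differentiable_continuous; apply/derivable1_diffP.
    by have [] := dFa _ s0.
  rewrite (@continuous_FTC2 _ _ Fa)//.
  - rewrite -EFinB lee_fin /Fa powR1 mulr1 gerBl mulr_ge0 ?powR_ge0// invr_ge0; exact: ltW.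
  - apply: continuous_in_subspaceT => s /set_mem/=; rewrite in_itv/= => /andP[ns _].
    by apply: powR_continuous_at; exact: lt_le_trans ns.
  - split.
    + move=> s; rewrite in_itv/= => /andP[ns _].
      by have [] := dFa s (lt_trans n0 ns).
    + by apply: cvg_at_right_filter; exact: Fa_cont.
    + by apply: cvg_at_left_filter; exact: Fa_cont.
  - move=> s; rewrite in_itv/= => /andP[ns _].
    by rewrite derive1E; have [_] := dFa s (lt_trans n0 ns).
have mpow : measurable_fun [set: R] (fun s : R => (s `^ (a - 1))%:E).
  by apply/measurable_EFinP; exact: measurable_powR.
have -> : `]0 : R, 1]%classic = \bigcup_n F n.
  apply/seteqP; split=> s /=.
    rewrite in_itv/= => /andP[s0 s1].
    have si0 : 0 <= s^-1 by rewrite invr_ge0 ltW.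
    exists (Num.bound s^-1) => //; rewrite /F /= in_itv/= s1 andbT.
    rewrite invf_ple ?posrE//; apply: ltW; apply: (lt_le_trans (archi_boundP si0)).
    by rewrite ler_nat -addn2 leq_addr.
  move=> [k _]; rewrite /F /= !in_itv/= => /andP[ks ->]; rewrite andbT.
  by apply: lt_le_trans ks; rewrite invr_gt0.
have cvgF : (\int[lebesgue_measure]_(s in F n) (s `^ (a - 1))%:E @[n --> \oo] -->
             \int[lebesgue_measure]_(s in \bigcup_n F n) (s `^ (a - 1))%:E)%E.
  apply: ge0_nondecreasing_set_cvg_integral => //.
  - apply/nondecreasing_seqP => k; apply/subsetPset => s /=.
    rewrite /F /= !in_itv/= => /andP[ks ->]; rewrite andbT; apply: le_trans ks.
    by rewrite lef_pV2 ?posrE// ler_nat.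
  - by move=> k; exact: measurable_itv.
  - by move=> k; exact: measurable_funTS.
  - by move=> k s _; rewrite lee_fin powR_ge0.
apply: (@le_lt_trans _ _ (a^-1)%:E); last exact: ltry.
rewrite -(cvg_lim _ cvgF)//; apply: lime_le; first by apply/cvg_ex; eexists; exact: cvgF.
exact: nearW.
Qed.

(** The integral enters through [fine], which sends an infinite value to 0, so
    positivity requires finiteness. The integrand is at most
    s^(a - 1) on ]0, 1] and at most exp(- s) beyond. *)
Lemma Gamma_gt0 a : 0 < a -> a <= 1 -> 0 < Gamma a.
Proof.
move=> a0 a1; rewrite /Gamma /Rintegral fine_gt0//.
pose f (s : R) : R := s `^ (a - 1) * expR (- s).
have f0 s : 0 <= f s by rewrite mulr_ge0 ?powR_ge0 ?expR_ge0.
have mf : measurable_fun [set: R] (EFin \o f).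
  apply/measurable_EFinP; apply: measurable_funM; first exact: measurable_powR.
  by apply: measurableT_comp => //; exact: measurable_expR.
rewrite -/f; apply/andP; split.
  apply: ge0_integral_gt0 => //.
  - exact: measurable_funTS.
  - by move=> s _; rewrite lee_fin; exact: f0.
  - apply: aeW => s /=; rewrite in_itv/= andbT => s0.
    by rewrite lte_fin mulr_gt0 ?powR_gt0 ?expR_gt0.
  - have : (0 < lebesgue_measure `]0%R : R, +oo[%classic)%E.
      by rewrite lebesgue_measure_itv/= ltry oppr0 addye// ltry.
    exact.
set D := (X in integral _ X _).
have -> : D = `]0 : R, 1]%classic `|` `]1 : R, +oo[%classic.
  apply/seteqP; split=> s /=; rewrite /D /= !in_itv/= ?andbT.
    by move=> s0; have [s1|s1] := leP s 1; [left; rewrite s0|right].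
  by case=> [/andP[]//|]; exact: lt_trans.
rewrite ge0_integral_setU//; last 3 first.
- exact: measurable_funTS.
- by move=> s _; rewrite lee_fin; exact: f0.
- rewrite disj_set2E; apply/eqP/seteqP; split=> // s [] /=.
  by rewrite !in_itv/= => /andP[_ s1]; rewrite andbT ltNge s1.
apply: lte_add_pinfty.
  apply: le_lt_trans (integral_powR_lty a0).
  apply: ge0_le_integral => //.
  - by move=> s _; rewrite lee_fin; exact: f0.
  - exact: measurable_funTS.
  - by apply: measurable_funTS; apply/measurable_EFinP; exact: measurable_powR.
  - move=> s /=; rewrite in_itv/= => /andP[s0 _]; rewrite lee_fin ler_piMr ?powR_ge0//.
    by rewrite -expR0 ler_expR oppr_le0 ltW.
apply: (@le_lt_trans _ _ 1%E); last exact: ltry.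
rewrite -(@integral_exponential_pdf R 1 ltr01).
apply: (@le_trans _ _ (\int[lebesgue_measure]_(s in `]1%R, +oo[) (exponential_pdf 1 s)%:E)%E).
  apply: ge0_le_integral => //.
  - by move=> s _; rewrite lee_fin; exact: f0.
  - exact: measurable_funTS.
  - by apply: measurable_funTS; apply/measurable_EFinP; exact: measurable_exponential_pdf.
  - move=> s /=; rewrite in_itv/= andbT => s1.
    have s0 : 0 <= s by rewrite ltW// (lt_trans _ s1).
    rewrite lee_fin exponential_pdfE// mul1r mulN1r ler_piMl ?expR_ge0//.
    by rewrite -[leRHS](powRr0 s) ler_powR ?(ltW s1)// subr_le0.
apply: ge0_subset_integral => //.
- by apply/measurable_EFinP; exact: measurable_exponential_pdf.
- by move=> s _; rewrite lee_fin exponential_pdf_ge0.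
Qed.

End gamma.

(** * Positivity, symmetry and semicontinuity of the Green kernel *)

Section manifold.
Context {R : realType} {n : nat} {M : ptopologicalType}.
Variable g : riemannian_manifold R n M.

(** Preimages of balls in a chart form a countable basis of neighbourhoods. *)
Lemma not_nbhs_seq (x : M) (A : set M) : ~ nbhs x A ->
  exists2 z : nat -> M, z @ \oo --> x & forall k, ~ A (z k).
Proof.
move=> xA; pose c := chart_at g x.
have [oc _ cK cmap_cont cinv_cont] := atlas_chart (chart_at_atlas g x : atlas g c).
have cx : cdom c x by exact: chart_at_dom.
have zP k : exists y, [/\ cdom c y, ball (cmap c x) k.+1%:R^-1 (cmap c y) & ~ A y].
  apply: contrapT => noy; apply: xA.
  have cN : nbhs x (cdom c `&` cmap c @^-1` ball (cmap c x) k.+1%:R^-1).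
    apply: filterI; first exact: open_nbhs_nbhs.
    by apply: cmap_cont => //; apply: nbhsx_ballx; rewrite invr_gt0.
  apply: filterS cN => y [cy yb]; apply: contrapT => nAy.
  by apply: noy; exists y.
have [z zk] := choice zP; exists z; last by move=> k; have [] := zk k.
have cz : cmap c (z k) @[k --> \oo] --> cmap c x.
  apply/cvg_ballP => e e0; have ei0 : 0 <= e^-1 by rewrite invr_ge0 ltW.
  exists (Num.bound e^-1) => // k /= ek; have [_ + _] := zk k.
  apply: le_ball; rewrite invf_ple ?posrE//.
  apply: ltW; apply: (lt_le_trans (archi_boundP ei0)).
  by rewrite ler_nat (leq_trans ek).
have ci : cinv c @ cmap c x --> cinv c (cmap c x).
  by apply: cinv_cont; exists x.
rewrite cK// in ci.
have := cvg_comp _ _ cz ci; apply: cvg_trans; apply: near_eq_cvg.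
by apply: nearW => k /=; have [czk _ _] := zk k; rewrite cK.
Qed.

Variables (p : R -> M -> M -> R) (alpha : R).
Hypotheses (p_smooth : smooth_kernel g p) (alpha0 : 0 < alpha) (alpha1 : alpha <= 1).
Hypothesis p_gt0 : forall t x y, 0 < t -> 0 < p t x y.
Hypothesis p_sym : forall t x y, 0 < t -> p t x y = p t y x.

Lemma heat_kernel_continuous_time x y t : 0 < t ->
  {for t, continuous (fun s : R => p s x y)}.
Proof.
move=> t0; have s_cvg : s @[s --> (t : R^o)] --> (t : R^o) by exact: cvg_id.
have xy_cvg : (x, y) @[_ --> (t : R^o)] --> (x, y) by exact: cvg_cst.
have tz : ((s : R^o), (x, y)) @[s --> (t : R^o)] --> ((t : R^o), (x, y)).
  exact: cvg_pair s_cvg xy_cvg.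
exact: (cvg_comp _ _ tz (@heat_kernel_cvg _ _ _ _ _ p_smooth t x y t0)).
Qed.

Lemma heat_kernel_continuous_space x y t : 0 < t ->
  p t z y @[z --> x] --> p t x y.
Proof.
move=> t0; have t_cvg : (t : R^o) @[_ --> x] --> (t : R^o) by exact: cvg_cst.
have z_cvg : z @[z --> x] --> x by exact: cvg_id.
have y_cvg : y @[_ --> x] --> y by exact: cvg_cst.
have zy_cvg : (z, y) @[z --> x] --> (x, y) by exact: cvg_pair z_cvg y_cvg.
have tz : ((t : R^o), (z, y)) @[z --> x] --> ((t : R^o), (x, y)).
  exact: cvg_pair t_cvg zy_cvg.
exact: (cvg_comp _ _ tz (@heat_kernel_cvg _ _ _ _ _ p_smooth t x y t0)).
Qed.

Let f x y (s : R) : \bar R := ((Gamma alpha)^-1 * (s `^ (alpha - 1) * p s x y))%:E.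

Let Gamma0 : 0 < Gamma alpha. Proof. exact: Gamma_gt0. Qed.

Let f_gt0 x y s : 0 < s -> (0 < f x y s)%E.
Proof. by move=> s0; rewrite lte_fin !mulr_gt0 ?invr_gt0 ?powR_gt0 ?p_gt0. Qed.

Let f_ge0 x y s : `]0%R, +oo[%classic s -> (0 <= f x y s)%E.
Proof. by rewrite /= in_itv/= andbT => s0; exact/ltW/f_gt0. Qed.

Let mp x y : measurable_fun `]0 : R, +oo[%classic (fun s => s `^ (alpha - 1) * p s x y).
Proof.
apply: measurable_funM; first by apply: measurable_funTS; exact: measurable_powR.
apply: open_continuous_measurable_fun => // s; rewrite inE/= in_itv/= andbT.
exact: heat_kernel_continuous_time.
Qed.

Let mf x y : measurable_fun `]0 : R, +oo[%classic (f x y).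
Proof. by apply/measurable_EFinP; apply: measurable_funM => //; exact: mp. Qed.

(** Moving the constant under the integral lets Fatou's lemma and positivity apply
    to the kernel itself. *)
Lemma greenE x y : green p alpha x y = (\int[lebesgue_measure]_(s in `]0%R, +oo[) f x y s)%E.
Proof.
rewrite /green /f; under [RHS]eq_integral => s _ do rewrite EFinM.
rewrite ge0_integralZl//.
- by apply/measurable_EFinP; exact: mp.
- move=> s /=; rewrite in_itv/= andbT => s0.
  by rewrite lee_fin mulr_ge0 ?powR_ge0// ltW// p_gt0.
- by rewrite lee_fin invr_ge0 ltW.
Qed.

Lemma green_gt0 x y : (0 < green p alpha x y)%E.
Proof.
rewrite greenE; apply: ge0_integral_gt0 => //; [exact: mf|exact: f_ge0| |].
- apply: aeW => s /=; rewrite in_itv/= andbT; exact: f_gt0.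
- have : (0 < lebesgue_measure `]0%R : R, +oo[%classic)%E.
    by rewrite lebesgue_measure_itv/= ltry oppr0 addye// ltry.
  exact.
Qed.

Lemma green_sym x y : green p alpha x y = green p alpha y x.
Proof.
congr (_ * _)%E; apply: eq_integral => s; rewrite inE/= in_itv/= andbT => s0.
by rewrite p_sym.
Qed.

(** If a superlevel set were not a neighbourhood of x, a sequence tending to x
    would stay outside of it, and Fatou's lemma would bound the value at x. *)
Lemma green_lower_semicontinuous y : lower_semicontinuous (fun x => green p alpha x y).
Proof.
move=> x a ax; exists [set z | (a%:E < green p alpha z y)%E] => //.
apply: contrapT => /not_nbhs_seq[z zx za].
move: ax; rewrite ltNge => /negP; apply.
rewrite greenE (_ : (\int[_]_(s in _) _ = \int[lebesgue_measure]_(s in `]0%R, +oo[)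
   limn_einf (fun k => f (z k) y s))%E); last first.
  apply: eq_integral => s; rewrite inE/= in_itv/= andbT => s0.
  symmetry; apply: (cvg_limn_einf_sup _).1.
  have p_cvg : p s (z k) y @[k --> \oo] --> p s x y.
    exact: (cvg_comp _ _ zx (@heat_kernel_continuous_space x y s s0)).
  apply: cvg_EFin; first exact: nearW.
  exact: (cvgM (cvg_cst _) (cvgM (cvg_cst _) p_cvg)).
apply: (@le_trans _ _ (limn_einf (fun k =>
    \int[lebesgue_measure]_(s in `]0%R, +oo[) f (z k) y s))%E).
  by apply: fatou => //; [move=> k; exact: mf|move=> k s; exact: f_ge0].
apply: limn_einf_le => k; rewrite -greenE leNgt; apply/negP; exact: za.
Qed.

Lemma measurable_green x : measurable_fun [set: borel M] (green p alpha x : borel M -> \bar R).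
Proof.
apply: measurable_fun_of_superlevels => a; rewrite setTI.
apply: open_measurable_borel.
rewrite (_ : [set _ | _] = [set y | (a%:E < green p alpha y x)%E]).
  by have /lower_semicontinuousP := @green_lower_semicontinuous x; exact.
by apply/seteqP; split=> y /=; rewrite green_sym.
Qed.

End manifold.

(** * The criterion *)

Local Open Scope ereal_scope.

Theorem theorem1p9 (R : realType) (n : nat) (M : ptopologicalType)
    (g : riemannian_manifold R n M)
    (M_complete : complete_manifold g)
    (M_connected : connected [set: M])
    (M_noncompact : ~ compact [set: M])
    (mu : {measure set (borel M) -> \bar R})
    (mu_riemannian : is_riemannian_measure g mu)
    (p : R -> M -> M -> R)
    (p_heat : is_heat_kernel g mu p)
    (alpha : R) (alpha_gt0 : (0 < alpha)%R) (alpha_lt1 : (alpha < 1)%R)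
    (q : R) (q_gt1 : (1 < q)%R)
    (sigma : {measure set (borel M) -> \bar R})
    (sigma_radon : locally_finite sigma)
    (G_transient : transient mu (green p alpha))
    (G_quasi_metric : quasi_metric (green p alpha))
    (o : M) (a : R) (a_gt0 : (0 < a)%R) :
  let G := green p alpha in
  let m x := Order.min (G x o) (a^-1)%:E in
  (exists u : M -> \bar R, positive_solution G q sigma u) <->
  (\int[sigma]_x (m x `^ q) < +oo /\
   exists2 C : R, (0 < C)%R &
     forall r : R, (a < r)%R ->
       ereal_sup [set \int[sigma]_(y in [set y : M | (r^-1)%:E < G o y]) G x y
                 | x in [set: M]]
       <= (C * r `^ (q - 1))%:E).
Proof.
move=> G m.
have [_ [_ [_ _ p_smooth p_gt0 _]]] := p_heat.
have p_sym t x y : (0 < t)%R -> p t x y = p t y x.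
  exact: (heat_kernel_sym p_heat mu_riemannian).
have G_gt0 x y : 0 < G x y.
  exact: (green_gt0 p_smooth alpha_gt0 (ltW alpha_lt1) p_gt0).
have G_sym x y : G x y = G y x by exact: green_sym.
have mG x : measurable_fun [set: borel M] (G x : borel M -> \bar R).
  exact: (measurable_green p_smooth alpha_gt0 (ltW alpha_lt1) p_gt0 p_sym).
have G_lsc y : lower_semicontinuous (fun x => G x y).
  exact: (green_lower_semicontinuous p_smooth alpha_gt0 (ltW alpha_lt1) p_gt0).
have [kappa kappa1 G_quasi] := G_quasi_metric.
split=> [[u [[v v_lsc uv] u_sol]]|[intm [C C0 test]]].
  have mv : measurable_fun [set: borel M] (v : borel M -> \bar R).
    apply: measurable_fun_of_superlevels => b; rewrite setTI.
    by apply: open_measurable_borel; have /lower_semicontinuousP := v_lsc; exact.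
  have mvq : measurable_fun [set: borel M] (fun y : borel M => v y `^ q).
    exact: (measurableT_comp (measurable_poweR q) mv).
  have v_pos : {ae sigma, forall x, 0 < v x < +oo}.
    by apply: (ae_imply2 uv u_sol) => x <- [].
  have v_super : {ae sigma, forall x, \int[sigma]_y (G x y * v y `^ q) <= v x}.
    apply: (ae_imply2 uv u_sol) => x <- [_]; apply: le_trans.
    apply: le_integral_of_ae_eq.
    - exact: emeasurable_funM.
    - by move=> y; rewrite mule_ge0 ?poweR_ge0// ltW.
    - by move=> y; rewrite mule_ge0 ?poweR_ge0// ltW.
    - by apply: (ae_imply uv) => y ->.
  (* without mass there is no ball of positive energy, and all integrals vanish *)
  have [sigma0|sigma_neq0] := eqVneq (sigma [set: borel M]) 0.
    split.
      rewrite ge0_integral_null//; apply: (measurableT_comp (measurable_poweR q)).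
      by apply: measurable_mine => //; under eq_fun do rewrite G_sym; exact: mG.
    exists 1%R => // r ar; apply: ge_ereal_sup => _ [x _ <-].
    rewrite ge0_integral_null//; first by rewrite lee_fin mul1r powR_ge0.
    by rewrite -[X in measurable X]setTI; exact: emeasurable_fun_o_infty.
  have sigma_gt0 : 0 < sigma [set: borel M] by rewrite lt0e sigma_neq0 measure_ge0.
  split; first exact: (@integral_truncation_lty _ (borel M) R sigma G kappa q a o
    G_gt0 G_sym mG kappa1 G_quasi q_gt1 a_gt0 v mv v_pos v_super sigma_gt0).
  have [C C0 ball_le] := @potential_ball_le _ (borel M) R sigma G kappa q a o
    G_gt0 G_sym mG kappa1 G_quasi q_gt1 a_gt0 v mv v_pos v_super sigma_gt0.
  exists C => // r ar; apply: ge_ereal_sup => _ [x _ <-].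
  exact: ball_le.
have test' r x : (a < r)%R ->
    \int[sigma]_(y in [set y : borel M | (r^-1)%:E < G o y]) G x y <= (C * r `^ (q - 1))%:E.
  by move=> ar; apply: le_trans (test r ar); apply: ereal_sup_ubound; exists x.
(* the solution is a multiple of m, lower semicontinuous because G(., o) is *)
have [C' C'0 Gm] := @potential_truncation_le _ (borel M) R sigma G kappa q a o
  G_gt0 G_sym mG kappa1 G_quasi q_gt1 a_gt0 C C0 intm test'.
have [e e0 super] := @exists_scaled_supersolution _ (borel M) R sigma G q a o
  G_gt0 G_sym mG q_gt1 a_gt0 C' C'0 Gm.
have m_gt0 x : 0 < m x by rewrite lt_min G_gt0 lte_fin invr_gt0.
exists (fun x => e%:E * m x); split.
  exists (fun x => e%:E * m x); last exact: aeW.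
  apply/lower_semicontinuousP => b.
  rewrite (_ : [set x | _] = [set x | (e^-1 * b)%:E < G x o] `&`
                             [set x | (e^-1 * b)%:E < (a^-1)%:E]); last first.
    have mb x : (b%:E < e%:E * m x) = ((e^-1 * b)%:E < m x).
      by rewrite EFinM lte_pdivrMl.
    apply/seteqP; split=> x /=; rewrite mb lt_min; first by move=> /andP[].
    by move=> [-> ->].
  apply: openI; first by have /lower_semicontinuousP := G_lsc o; exact.
  have [ba|ba] := ltP (e^-1 * b)%:E (a^-1)%:E.
    by rewrite (_ : [set _ | _] = setT); [exact: openT|apply/seteqP].
  by rewrite (_ : [set _ | _] = set0); [exact: open0|apply/seteqP; split].
apply: aeW => x; split; last exact: super.
rewrite mule_gt0//= lte_mul_pinfty ?lee_fin ?(ltW e0)//.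
by rewrite (le_lt_trans (_ : _ <= (a^-1)%:E)) ?ltry// ge_min lexx orbT.
Qed.
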